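(* Let $k$ be an infinite field, $S=k[x_1,\ldots,x_n]$ with the standard grading and the graded reverse lexicographic order with $x_1>x_2>\cdots>x_n$. Let $P$ be a homogeneous prime ideal of $S$ and let $J=\operatorname{gin}(P)$ be its generic initial ideal. Assume that, for some $1\le r\le n-1$ and some monomial $u\in \Pi_r(J):\mathfrak{m}(r)$ with $u\notin \Pi_r(J)$, one has $\overline{\Phi_r}(J)=\Pi_r(J)+(u)$ as ideals of $S(r)=k[x_1,\ldots,x_r]$. Then: (1) Either $u=1$ and $(x_1,\ldots,x_r)\subset J$, or $J$ is generated by $J\cap k[x_1,\ldots,x_r]$ and one extra monomial generator $v$. (2) If $u\neq 1$, then the extra generator is $v=ux_{r+1}^e$ for some $e>0$. (3) If $u\neq 1$, then $J$ is generated by monomials inside $k[x_1,\ldots,x_{r+1}]$.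
   Context: For a nonzero $f\in S$, $\operatorname{in}(f)$ is the largest monomial occurring in $f$ with nonzero coefficient, and $\operatorname{in}(I)=(\operatorname{in}(f)\mid 0\ne f\in I)$. For a homogeneous ideal $I$ there is a nonempty Zariski open set $U\subset GL_n(k)$ (acting on $S$ by linear changes of coordinates) such that $\operatorname{in}(\alpha(I))$ is the same for all $\alpha\in U$; this common ideal is the generic initial ideal $\operatorname{gin}(I)$. $S(r)=k[x_1,\ldots,x_r]$ and $\mathfrak{m}(r)=(x_1,\ldots,x_r)\subset S(r)$. The map $\Pi_r:S\to S(r)$ is the $k$-algebra map fixing $x_1,\ldots,x_r$ and sending $x_{r+1},\ldots,x_n$ to $0$; $\Pi_r(J)$ is the image ideal in $S(r)$. For a monomial $w=x_1^{a_1}\cdots x_n^{a_n}$ put $\Phi_r(w)=x_1^{a_1}\cdots x_r^{a_r}$. For a monomial ideal $J$ with minimal monomial generators $u_1,\ldots,u_m$, $\Phi_r(J)=(\Phi_r(u_1),\ldots,\Phi_r(u_m))S=J:(x_{r+1}\cdots x_n)^\infty$, and $\overline{\Phi_r}(J)=\Pi_r(\Phi_r(J))$ is the ideal of $S(r)$ generated by the same monomials $\Phi_r(u_1),\ldots,\Phi_r(u_m)$. *)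

(* Defs.v *)
From HB Require Import structures.
From mathcomp Require Import all_boot all_order all_algebra.
From mathcomp Require Import mpoly.

Set Implicit Arguments.
Unset Strict Implicit.
Unset Printing Implicit Defensive.

Import GRing.Theory.
Local Open Scope ring_scope.

Definition infinite_field (k : fieldType) : Prop :=
  forall s : seq k, exists x, x \notin s.

(** Ideals are [Prop]-valued predicates, because membership in the ideals
    built below (generated ideals, initial ideals) is not a boolean. *)

Definition same_ideal (T : Type) (I J : T -> Prop) : Prop :=
  forall f, I f <-> J f.

Definition is_ideal (R : comNzRingType) (I : R -> Prop) : Prop :=
  [/\ I 0,
      forall a b, I a -> I b -> I (a + b)
    & forall c a, I a -> I (c * a)].

Definition is_prime_ideal (R : comNzRingType) (I : R -> Prop) : Prop :=
  [/\ is_ideal I,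
      ~ I 1
    & forall a b, I (a * b) -> I a \/ I b].

Definition ideal_gen (R : comNzRingType) (G : R -> Prop) (f : R) : Prop :=
  exists2 s : seq (R * R),
    forall p, p \in s -> G p.2 & f = \sum_(p <- s) p.1 * p.2.

Definition ideal_add (R : comNzRingType) (I J : R -> Prop) (f : R) : Prop :=
  exists a b, [/\ I a, J b & f = a + b].

Definition ideal_colon (R : comNzRingType) (I J : R -> Prop) (f : R) : Prop :=
  forall g, J g -> I (f * g).

Definition is_homogeneous_ideal (n : nat) (k : fieldType)
    (I : {mpoly k[n]} -> Prop) : Prop :=
  is_ideal I /\ forall f d, I f -> I (pihomog mdeg d f).

(** The library's order on ['X_{1..n}], hence [mlead], compares exponent
    vectors lexicographically from the first variable within each degree.  That
    is the graded lexicographic order (despite the header of mpoly), so the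
    graded reverse lexicographic order with x_1 > ... > x_n is defined here. *)
Definition grevlex_lt (n : nat) (m1 m2 : 'X_{1..n}) : bool :=
  (mdeg m1 < mdeg m2)%N
  || (mdeg m1 == mdeg m2) &&
     [exists i : 'I_n, (m2 i < m1 i)%N &&
        [forall j : 'I_n, (i < j)%N ==> (m1 j == m2 j)]].

(** [m] is in(f); no [m] satisfies this when [f = 0]. *)
Definition is_initial (n : nat) (k : fieldType) (f : {mpoly k[n]})
    (m : 'X_{1..n}) : Prop :=
  m \in msupp f /\ forall m', m' \in msupp f -> m' != m -> grevlex_lt m' m.

Definition initial_ideal (n : nat) (k : fieldType) (I : {mpoly k[n]} -> Prop) :
    {mpoly k[n]} -> Prop :=
  ideal_gen (fun g => exists f m,
    [/\ I f, f != 0, is_initial f m & g = 'X_[m]]).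

(** The linear change of coordinates x_j |-> \sum_i A_ij x_i. *)
Definition lin_change (n : nat) (k : fieldType) (A : 'M[k]_n)
    (f : {mpoly k[n]}) : {mpoly k[n]} :=
  f \mPo [tuple \sum_(i < n) A i j *: 'X_i | j < n].

Definition image_ideal (T T' : Type) (phi : T -> T') (I : T -> Prop) (g : T') :
    Prop :=
  exists2 f, I f & g = phi f.

(** GL_n(k) is open in the affine space of matrices, so its Zariski open
    subsets are cut out by the non-vanishing of at least one polynomial, among
    some family [F] of polynomials in the [n * n] entries. *)
Definition zariski_open_GL (n : nat) (k : fieldType) (U : 'M[k]_n -> Prop) :
    Prop :=
  exists F : {mpoly k[n * n]} -> Prop,
    forall A, U A <->
      A \in unitmx /\ exists2 f, F f & f.@[fun i => mxvec A 0 i] != 0.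

(** [J] is gin(I).  Over an infinite field two nonempty open subsets of GL_n
    meet, so there is at most one such [J] up to [same_ideal]. *)
Definition is_gin (n : nat) (k : fieldType) (I J : {mpoly k[n]} -> Prop) :
    Prop :=
  exists U : 'M[k]_n -> Prop,
    [/\ zariski_open_GL U,
        exists A, U A
      & forall A, U A ->
          same_ideal (initial_ideal (image_ideal (lin_change A) I)) J].

Definition max_ideal (r : nat) (k : fieldType) : {mpoly k[r]} -> Prop :=
  ideal_gen (fun g => exists i : 'I_r, g = 'X_i).

(** [insub] sends an index [i : 'I_n] to the same index in ['I_r] when
    [i < r], and to [None] otherwise. *)
Definition Pi (n r : nat) (k : fieldType) (f : {mpoly k[n]}) : {mpoly k[r]} :=
  f \mPo [tuple (if insub (val i) is Some j then 'X_(j : 'I_r) else 0) | i < n].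

Definition Pi_ideal (n r : nat) (k : fieldType) (J : {mpoly k[n]} -> Prop) :
    {mpoly k[r]} -> Prop :=
  image_ideal (@Pi n r k) J.

Definition min_mon_gen (n : nat) (k : fieldType) (J : {mpoly k[n]} -> Prop)
    (m : 'X_{1..n}) : Prop :=
  J 'X_[m] /\ forall m', J 'X_[m'] -> (m' <= m)%MM -> m' = m.

Definition Phi (n r : nat) (m : 'X_{1..n}) : 'X_{1..n} :=
  [multinom (if (i < r)%N then m i else 0%N) | i < n].

Definition Phi_ideal (n r : nat) (k : fieldType) (J : {mpoly k[n]} -> Prop) :
    {mpoly k[n]} -> Prop :=
  ideal_gen (fun g => exists2 m, min_mon_gen J m & g = 'X_[Phi r m]).

Definition Phibar_ideal (n r : nat) (k : fieldType)
    (J : {mpoly k[n]} -> Prop) : {mpoly k[r]} -> Prop :=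
  Pi_ideal (Phi_ideal r J).

(** A monomial of k[x_1, ..., x_r] viewed in k[x_1, ..., x_n]. *)
Definition mnm_embed (n r : nat) (u : 'X_{1..r}) : 'X_{1..n} :=
  [multinom (if insub (val i) is Some j then u (j : 'I_r) else 0%N) | i < n].

Definition mnm_in_first (n r : nat) (m : 'X_{1..n}) : Prop :=
  forall i : 'I_n, (r <= i)%N -> m i = 0%N.

(** The subring k[x_1, ..., x_r] of k[x_1, ..., x_n]. *)
Definition in_first (n r : nat) (k : fieldType) (f : {mpoly k[n]}) : Prop :=
  forall m, m \in msupp f -> mnm_in_first r m.

(** [J] is generated by its elements lying in k[x_1, ..., x_r] together with
    the monomial [v], which those elements do not already generate. *)
Definition extra_generator (n r : nat) (k : fieldType)
    (J : {mpoly k[n]} -> Prop) (v : 'X_{1..n}) : Prop :=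
  ~ ideal_gen (fun g => J g /\ in_first r g) 'X_[v] /\
  same_ideal J
    (ideal_gen (fun g => (J g /\ in_first r g) \/ g = 'X_[v])).

(* Main.v *)
Require Import Defs.
From HB Require Import structures.
From mathcomp Require Import all_boot all_order all_algebra.
From mathcomp Require Import mpoly.
From Stdlib Require Import Classical.

Set Implicit Arguments.
Unset Strict Implicit.
Unset Printing Implicit Defensive.

Import GRing.Theory.
Local Open Scope ring_scope.

(** Why the theorem is true.

    Replace [P] by a generic linear transform of it, so that in(P) = J, write
    S = k[x_1, ..., x_n], B = k[x_(r+1), ..., x_n], and view S as the free
    B-module on the monomials [w] of k[x_1, ..., x_r].  The hypotheses on [u]
    say that every monomial of [J] either has its first part [Phi r m] already
    in [J], or has first part exactly [u] ([Phi_dichotomy] in the proof of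
    [theorem4p2]).  Let W be the span over B of the [w] outside [J].  Modulo [P]
    every polynomial reduces to W ([reduce_initial]), and an element of W in [P]
    has its initial monomial in [u B]; so it vanishes as soon as its
    [u]-coefficient in B does ([reduced_coef_eq0]).

    If [u] is not 1, then 1 is in W, so [P] meets B in 0, and S/P is torsion-free
    over B because [P] is prime.  Thus the elements of W in [P] are the relations
    between the generators [w] of a torsion-free B-module, and form a reflexive
    module of rank one.  As B is factorial, that module is free: it consists of
    the multiples of one element [g] ([reduced_generator]).  Concretely, [g] is
    chosen with [u]-coefficient of least degree; two relations are proportional
    over B, and a prime factor of the [u]-coefficient of [g] cannot divide [g].
    Hence the monomials of [J] with first part [u] are the multiples of one of
    them, [v] = in(g) ([least_initial_monomial]).  Factoriality of polynomial
    rings is Gauss's lemma ([factorial_domain_mpoly]).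

    It remains to see that [v] is [u] times a power of x_(r+1).  A generic
    change of coordinates x_j |-> x_j + l_j x_(r+1) of the last variables, which
    also rescales x_(r+1), maps W to W and preserves [J], while it makes a power
    of x_(r+1) appear in the top-degree part of the [u]-coefficient of an element
    of W in [P].  In the graded reverse lexicographic order that power is the
    largest monomial of its degree in B, so [J] contains [u] times a power of
    x_(r+1) ([gin_contains_power]), and [v] divides that product. *)

(** * Polynomial rings over a field are factorial *)

Definition divides (R : comNzRingType) (a b : R) : Prop := exists c, b = a * c.

Definition prime_element (R : idomainType) (p : R) : Prop :=
  [/\ p != 0, p \isn't a GRing.unit
    & forall a b, divides p (a * b) -> divides p a \/ divides p b].

Inductive prime_product (R : idomainType) : R -> Prop :=
| PrimeProductUnit a : a \is a GRing.unit -> prime_product a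
| PrimeProductMul p a : prime_element p -> prime_product a ->
    prime_product (p * a).

Definition factorial_domain (R : idomainType) : Prop :=
  forall a : R, a != 0 -> prime_product a.

Lemma divides_mulr (R : comNzRingType) (p a b : R) :
  divides p a -> divides p (a * b).
Proof. by case=> c ->; exists (c * b); rewrite mulrA. Qed.

Lemma divides_mull (R : comNzRingType) (p a b : R) :
  divides p a -> divides p (b * a).
Proof. by rewrite mulrC; apply: divides_mulr. Qed.

Lemma prime_product_mul (R : idomainType) (a b : R) :
  prime_product a -> prime_product b -> prime_product (a * b).
Proof.
move=> pa pb; elim: pa => [c uc | p c pp _ IH].
  elim: pb => [d ud | p d pp pd IH].
    by apply: PrimeProductUnit; rewrite unitrM uc.
  by rewrite mulrCA; apply: PrimeProductMul.
by rewrite -mulrA; apply: PrimeProductMul.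
Qed.

Section PolyFactorial.
Variable R : idomainType.

Lemma divides_polyC (p : R) (f : {poly R}) :
  divides p%:P f <-> forall i, divides p f`_i.
Proof.
split=> [[g ->] i|]; first by exists g`_i; rewrite coefCM.
elim/poly_ind: f => [|f c IH] dv; first by exists 0; rewrite mulr0.
have [g ->] : divides p%:P f.
  by apply: IH => i; have := dv i.+1; rewrite coefD coefMX coefC addr0.
have [d] := dv 0; rewrite coefD coefMX coefC add0r /= => ->.
by exists (g * 'X + d%:P); rewrite mulrDr mulrA polyCM.
Qed.

Lemma divides_polyC_MX (p : R) (f : {poly R}) :
  divides p%:P (f * 'X) -> divides p%:P f.
Proof.
move=> /divides_polyC dv; apply/divides_polyC => i.
by have := dv i.+1; rewrite coefMX.
Qed.

Lemma divides_sub (p a b : {poly R}) :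
  divides p (a + b) -> divides p b -> divides p a.
Proof. by move=> [c e] [d eb]; exists (c - d); rewrite mulrBr -e -eb addrK. Qed.

(** Induction on both factors: the constant term of the product shows that [p]
    divides the constant term of one factor, which can then be shortened. *)
Lemma prime_element_polyC (p : R) : prime_element p -> prime_element p%:P.
Proof.
case=> p0 pu pr; split; first by rewrite polyC_eq0.
  by rewrite poly_unitE coefC eqxx negb_and pu orbT.
elim/poly_ind => [|f a IHf] g; first by left; exists 0; rewrite mulr0.
elim/poly_ind: g => [|g b IHg] dv; first by right; exists 0; rewrite mulr0.
have /pr[pa|pb] : divides p (a * b).
- by have /divides_polyC/(_ 0) := dv; rewrite coef0M !coefD !coefMX !coefC !add0r.
- have pa' : divides p%:P a%:P by case: pa => c ->; exists c%:P; rewrite polyCM.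
  have /divides_polyC_MX/IHf[pf|pg] : divides p%:P (f * (g * 'X + b%:P) * 'X).
  + apply: (divides_sub (b := a%:P * (g * 'X + b%:P))); last exact: divides_mulr.
    by move: dv; rewrite [X in _ -> divides _ (X + _)]mulrAC -mulrDl.
  + left; case: pf => c ->; case: pa' => d ->; exists (c * 'X + d).
    by rewrite mulrDr mulrA.
  + by right.
- have pb' : divides p%:P b%:P by case: pb => c ->; exists c%:P; rewrite polyCM.
  have /divides_polyC_MX/IHg[pf|pg] : divides p%:P ((f * 'X + a%:P) * g * 'X).
  + apply: (divides_sub (b := (f * 'X + a%:P) * b%:P)); last exact: divides_mull.
    by move: dv; rewrite -mulrA -mulrDr.
  + by left.
  + right; case: pg => c ->; case: pb' => d ->; exists (c * 'X + d).
    by rewrite mulrDr mulrA.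
Qed.

Lemma prime_product_polyC (a : R) : prime_product a -> prime_product a%:P.
Proof.
elim=> [c uc | p c pp _ IH].
  apply: PrimeProductUnit; rewrite poly_unitE size_polyC coefC eqxx uc.
  by rewrite (contraTneq _ uc) // => ->; rewrite unitr0.
by rewrite polyCM; apply: PrimeProductMul => //; apply: prime_element_polyC.
Qed.

Definition primitive_poly (f : {poly R}) : Prop :=
  forall p, prime_element p -> ~ divides p%:P f.

(** A factorization over the fraction field clears its denominator [c] one prime
    at a time, since a prime constant divides one of the two factors. *)
Lemma size_factorization_polyC (c : R) (f g h : {poly R}) :
  prime_product c -> c%:P * f = g * h ->
  exists g' h', [/\ f = g' * h', size g' = size g & size h' = size h].
Proof.
move=> pc; elim: pc f g h => [d ud | p d pp _ IH] f g h.
  move=> e; exists (d^-1%:P * g), h; split=> //; last first.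
    by rewrite size_Cmul // invr_eq0; apply: contraTneq ud => ->; rewrite unitr0.
  by rewrite -mulrA -e mulrA -polyCM mulVr // mul1r.
have [p0 _ _] := pp; have [_ _ pr] := prime_element_polyC pp.
have pP0 : p%:P != 0 by rewrite polyC_eq0.
rewrite polyCM -mulrA => e.
have /pr[[g1 eg]|[h1 eh]] : divides p%:P (g * h) by exists (d%:P * f).
  move: e; rewrite eg -mulrA size_Cmul // => /(mulfI pP0)/IH[g' [h' [-> <- <-]]].
  by exists g', h'.
move: e; rewrite eh [RHS]mulrCA size_Cmul // => /(mulfI pP0)/IH[g' [h' [-> <- <-]]].
by exists g', h'.
Qed.

Lemma primitive_divides (c : R) (f g : {poly R}) :
  primitive_poly f -> prime_product c -> divides f (c%:P * g) -> divides f g.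
Proof.
move=> prf pc; elim: pc g => [d ud | p d pp _ IH] g [w e].
  by exists (d^-1%:P * w); rewrite mulrCA -e mulrA -polyCM mulVr // mul1r.
have [p0 _ _] := pp; have [_ _ pr] := prime_element_polyC pp.
have pP0 : p%:P != 0 by rewrite polyC_eq0.
move: e; rewrite polyCM -mulrA => e.
have /pr[/(prf _ pp)//|[w1 ew]] : divides p%:P (f * w) by exists (d%:P * g).
by apply: IH; exists w1; move: e; rewrite ew [RHS]mulrCA => /(mulfI pP0).
Qed.

(** Irreducibility over the fraction field is expressed by multiples [c * f].
    If [f] divides [g * h], then over the fraction field either [f] is coprime to
    [g], and a Bezout relation makes it divide [h], or [f] divides [g];
    [primitive_divides] removes the denominators. *)
Lemma primitive_irreducible_prime (f : {poly R}) :
  factorial_domain R -> (1 < size f)%N -> primitive_poly f ->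
  (forall c g h, c != 0 -> c%:P * f = g * h ->
     (size g <= 1)%N \/ (size h <= 1)%N) ->
  prime_element f.
Proof.
move=> UR sf prf irr.
have f0 : f != 0 by rewrite -size_poly_gt0 ltnW.
split=> // [|g h [w ew]].
  by rewrite poly_unitE; apply/nandP; left; rewrite neq_ltn sf orbT.
have [/Pdiv.Idomain.Bezout_coprimepP[[s t] /= st]|ncop] := boolP (coprimep f g).
  have /size_poly1P[c c0 ec] : size (s * f + t * g) == 1%N.
    by rewrite Pdiv.Idomain.size_poly_eq1.
  right; apply: (primitive_divides prf (UR _ c0)).
  exists (s * h + t * w).
  by rewrite -ec mulrDl -(mulrA t) ew mulrDr (mulrCA f t) (mulrC s) -(mulrA f).
left; set d := gcdp f g in ncop.
have d0 : d != 0 by rewrite gcdp_eq0 negb_and f0.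
have sd : (1 < size d)%N.
  by rewrite ltn_neqAle eq_sym ncop size_poly_gt0.
have /Pdiv.Idomain.dvdpP[[c q] /= c0 ecf] := Pdiv.Idomain.dvdp_gcdl f g.
have /Pdiv.Idomain.dvdpP[[c' q'] /= c'0 ecg] := Pdiv.Idomain.dvdp_gcdr f g.
rewrite -mul_polyC in ecf; rewrite -mul_polyC in ecg.
have [sq|] := irr _ _ _ c0 ecf; last by rewrite leqNgt sd.
have q0 : q != 0.
  apply: contraNneq f0 => q0; move/eqP: ecf.
  by rewrite q0 mul0r mulf_eq0 polyC_eq0 (negbTE c0).
have /size_poly1P[k k0 ek] : size q == 1%N by rewrite eqn_leq sq size_poly_gt0.
apply: (primitive_divides prf (UR (k * c') _)); first by rewrite mulf_neq0.
exists (c%:P * q').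
by rewrite polyCM -mulrA ecg [RHS]mulrCA [RHS]mulrA ecf ek -mulrA (mulrC (gcdp f g)).
Qed.

(** The measure [mu] of the leading coefficient decreases when a constant prime
    factor is removed, so that every polynomial has a primitive part. *)
Lemma factorial_domain_poly (mu : R -> nat) :
  (forall a b, a != 0 -> b != 0 -> a \isn't a GRing.unit ->
     (mu b < mu (a * b)%R)%N) ->
  factorial_domain R -> factorial_domain {poly R}.
Proof.
move=> mulM UR f f0.
have [N] := ubnP (size f); elim: N f f0 => // N IHN f f0.
have [M] := ubnP (mu (lead_coef f)).
elim: M f f0 => // M IHM f f0 muf; rewrite ltnS => sN.
have [sf|sf] := leqP (size f) 1.
  have /size_poly1P[c c0 ->] : size f == 1%N by rewrite eqn_leq sf size_poly_gt0.
  exact/prime_product_polyC/UR.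
have [[p [pp [g eg]]]|prf] :=
    classic (exists p, prime_element p /\ divides p%:P f).
  have [p0 pu _] := pp.
  have g0 : g != 0 by apply: contraNneq f0 => g0; rewrite eg g0 mulr0.
  rewrite eg; apply: PrimeProductMul; first exact: prime_element_polyC.
  apply: IHM => //; last by rewrite ltnS -(size_Cmul g p0) -eg.
  rewrite -ltnS; apply: leq_trans muf; rewrite ltnS eg lead_coefM lead_coefC.
  by apply: mulM; rewrite ?lead_coef_eq0.
have {}prf : primitive_poly f by move=> p pp dv; apply: prf; exists p.
have [[c [g [h [c0 e sg sh]]]]|irr] := classic (exists c g h,
    [/\ c != 0, c%:P * f = g * h, (1 < size g)%N & (1 < size h)%N]).
  have [g' [h' [ef eg eh]]] := size_factorization_polyC (UR _ c0) e.
  have g'0 : g' != 0 by rewrite -size_poly_gt0 eg ltnW.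
  have h'0 : h' != 0 by rewrite -size_poly_gt0 eh ltnW.
  have es := size_mul g'0 h'0; rewrite -ef eg eh in es.
  rewrite es in sN; rewrite ef.
  apply: prime_product_mul; apply: IHN => //.
    rewrite eg; apply: leq_trans sN.
    by rewrite -(subnKC sh) add2n addnS /= -[X in (X < _)%N]addn0 ltn_add2l.
  rewrite eh; apply: leq_trans sN.
  by rewrite -(subnKC sg) add2n addSn /= -[X in (X < _)%N]add0n ltn_add2r.
rewrite -[f]mulr1; apply: PrimeProductMul; last first.
  by apply: PrimeProductUnit; apply: unitr1.
apply: primitive_irreducible_prime => // c g h c0 e.
have [|sg] := leqP (size g) 1; first by left.
have [|sh] := leqP (size h) 1; first by right.
by case: irr; exists c, g, h.
Qed.

End PolyFactorial.

Lemma factorial_domain_iso (R S : idomainType)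
    (f : {rmorphism R -> S}) (g : {rmorphism S -> R}) :
  cancel f g -> cancel g f -> factorial_domain S -> factorial_domain R.
Proof.
move=> fK gK US a a0.
have fa0 : f a != 0 by apply: contraNneq a0 => fa0; rewrite -[a]fK fa0 rmorph0.
rewrite -[a]fK; elim: (US _ fa0) => [b ub | p b [p0 pu pr] _ IH].
  by apply: PrimeProductUnit; apply: rmorph_unit.
rewrite rmorphM; apply: PrimeProductMul => //; split.
- by apply: contraNneq p0 => gp0; rewrite -[p]gK gp0 rmorph0.
- by apply: contra pu => ug; rewrite -[p]gK; apply: rmorph_unit.
move=> x y [c e].
have /pr[[d ed]|[d ed]] : divides p (f x * f y).
- by exists (f c); rewrite -rmorphM e rmorphM gK.
- by left; exists (g d); rewrite -rmorphM -ed fK.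
- by right; exists (g d); rewrite -rmorphM -ed fK.
Qed.

(** * Multivariate polynomials as univariate ones *)

Lemma mpoly_rmorphism_eq (n : nat) (k R : comNzRingType)
    (f g : {rmorphism {mpoly k[n]} -> R}) :
  (forall c, f c%:MP = g c%:MP) -> (forall i, f 'X_i = g 'X_i) -> f =1 g.
Proof.
move=> eC eX p; rewrite [p]mpolyE !rmorph_sum /=; apply: eq_bigr => m _.
rewrite -mul_mpolyC !rmorphM /= eC; congr (_ * _).
rewrite mpolyXE_id !rmorph_prod; apply: eq_bigr => i _.
by rewrite !rmorphXn /= eX.
Qed.

Section Muni.
Variables (n : nat) (k : comNzRingType).

Lemma mpoly_comm_widen (x : {mpoly k[n.+1]}) : commr_rmorph (@mwiden n k) x.
Proof. by move=> a; apply: mulrC. Qed.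

(** The inverse of [muni]. *)
Definition mpoly_of_poly : {poly {mpoly k[n]}} -> {mpoly k[n.+1]} :=
  horner_morph (mpoly_comm_widen 'X_ord_max).
HB.instance Definition _ := GRing.RMorphism.on mpoly_of_poly.

Lemma muniX_max : muni 'X_ord_max = 'X :> {poly {mpoly k[n]}}.
Proof.
rewrite /muni mmapX mmap1U; case: splitP => //= j ej.
by have := ltn_ord j; rewrite -ej ltnn.
Qed.

Lemma muniX_widen (i : 'I_n) :
  muni 'X_(widen_ord (leqnSn n) i) = ('X_i : {mpoly k[n]})%:P.
Proof.
rewrite /muni mmapX mmap1U; case: splitP => /= [j ej|j ej].
  by congr ('X__)%:P; apply: val_inj.
by have := ltn_ord i; rewrite ej ord1 addn0 ltnn.
Qed.

Lemma mwidenX1 (i : 'I_n) :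
  mwiden ('X_i : {mpoly k[n]}) = 'X_(widen_ord (leqnSn n) i).
Proof. by rewrite mwidenX mnmwiden1. Qed.

Lemma muniK : cancel (@muni n k) mpoly_of_poly.
Proof.
move=> p; apply: (mpoly_rmorphism_eq (f := mpoly_of_poly \o @muni n k)
  (g := idfun)) => [c|i] /=.
  by rewrite muniC /mpoly_of_poly /= horner_morphC /= mwidenC.
case: (unliftP ord_max i) => [j ->|->]; last first.
  by rewrite muniX_max /mpoly_of_poly /= horner_morphX.
have -> : lift ord_max j = widen_ord (leqnSn n) j.
  by apply: val_inj; rewrite /= /bump leqNgt ltn_ord.
by rewrite muniX_widen /mpoly_of_poly /= horner_morphC /= mwidenX1.
Qed.

Lemma mpoly_of_polyK : cancel mpoly_of_poly (@muni n k).
Proof.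
move=> p; rewrite -[RHS]comp_polyXr.
elim/poly_ind: p => [|p c IH].
  by rewrite rmorph0 muni0 comp_poly0.
rewrite rmorphD rmorphM /= muniD muniM IH comp_polyXr.
rewrite {1 2}/mpoly_of_poly /= horner_morphX horner_morphC muniX_max comp_polyXr.
congr (_ + _).
apply: (mpoly_rmorphism_eq (f := @muni n k \o @mwiden n k) (g := polyC)) => [d|i] /=.
  by rewrite mwidenC muniC.
by rewrite mwidenX1 muniX_widen.
Qed.

End Muni.

Lemma mpoly_unit_msize (k : fieldType) (n : nat) (f : {mpoly k[n]}) :
  f != 0 -> (f \is a GRing.unit) = (msize f <= 1)%N.
Proof.
move=> f0; apply/idP/idP => [/unitrP[g [e _]]|/msize1_polyC e].
  have g0 : g != 0 by apply: contra_eq_neq e => ->; rewrite mul0r eq_sym oner_neq0.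
  have := congr1 (fun h => msize h) e; rewrite /= msizeM // msize1.
  rewrite (mpolySpred _ f0) (mpolySpred _ g0) addSn addnS /= => -[/eqP].
  by rewrite addn_eq0 => /andP[_ /eqP ->].
have f00 : f@_0 != 0 by apply: contraNneq f0 => e0; rewrite e e0 mpolyC0.
by rewrite e; apply/unitrP; exists (f@_0)^-1%:MP; rewrite -!mpolyCM mulVf ?mulfV.
Qed.

Lemma msize_ltM (k : fieldType) (n : nat) (f g : {mpoly k[n]}) :
  f != 0 -> g != 0 -> f \isn't a GRing.unit -> (msize g < msize (f * g)%R)%N.
Proof.
move=> f0 g0; rewrite mpoly_unit_msize // -ltnNge => sf.
rewrite msizeM // -(subnKC sf) addSn /= addSn.
by rewrite ltnS leq_addl.
Qed.

(** The degree is the required measure, as units are the polynomials of degree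
    0. *)
Lemma factorial_domain_mpoly (k : fieldType) (n : nat) :
  factorial_domain {mpoly k[n]}.
Proof.
elim: n => [|n IH].
  move=> f f0; apply: PrimeProductUnit; rewrite mpoly_unit_msize //.
  by rewrite (nvar0_mpolyC f) msizeC leq_b1.
apply: (factorial_domain_iso (@muniK n k) (@mpoly_of_polyK n k)).
by apply: (factorial_domain_poly (@msize_ltM k n)).
Qed.

(** * The graded reverse lexicographic order *)

Section Grevlex.
Variable n : nat.
Implicit Types m : 'X_{1..n}.

Lemma grevlex_ltP m1 m2 :
  reflect ((mdeg m1 < mdeg m2)%N \/ mdeg m1 = mdeg m2 /\
             exists2 i : 'I_n, (m2 i < m1 i)%N &
               forall j : 'I_n, (i < j)%N -> m1 j = m2 j)
          (grevlex_lt m1 m2).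
Proof.
apply: (iffP orP) => [[lt|/andP[/eqP e /existsP[i /andP[lti /forallP h]]]]|].
- by left.
- right; split=> //; exists i => // j ij.
  by have := h j; rewrite ij => /eqP.
- case=> [lt|[e [i lti h]]]; [by left | right].
  rewrite e eqxx; apply/existsP; exists i; rewrite lti; apply/forallP => j.
  by apply/implyP => /h ->.
Qed.

Lemma grevlex_irr m : grevlex_lt m m = false.
Proof.
by apply/grevlex_ltP => -[|[_ [i]]]; rewrite ltnn.
Qed.

Lemma grevlex_trans m2 m1 m3 :
  grevlex_lt m1 m2 -> grevlex_lt m2 m3 -> grevlex_lt m1 m3.
Proof.
move=> /grevlex_ltP h12 /grevlex_ltP h23; apply/grevlex_ltP.
case: h12 => [lt12|[e12 [i lti hi]]]; case: h23 => [lt23|[e23 [j ltj hj]]].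
- by left; apply: ltn_trans lt23.
- by left; rewrite -e23.
- by left; rewrite e12.
right; split; first by rewrite e12.
have [ij|ji|/val_inj ij] := ltngtP i j.
- exists j => [|l jl]; first by rewrite (hi _ ij).
  by rewrite (hi _ (ltn_trans ij jl)) hj.
- exists i => [|l il]; first by rewrite -(hj _ ji).
  by rewrite hi // (hj _ (ltn_trans ji il)).
- subst j; exists i => [|l il]; first exact: ltn_trans lti.
  by rewrite hi // hj.
Qed.

Lemma grevlex_total m1 m2 : m1 != m2 -> grevlex_lt m1 m2 \/ grevlex_lt m2 m1.
Proof.
move=> ne; have [lt|lt|e] := ltngtP (mdeg m1) (mdeg m2).
- by left; apply/grevlex_ltP; left.
- by right; apply/grevlex_ltP; left.
have /existsP[i0 hi0] : [exists i, m1 i != m2 i].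
  apply/existsP/not_all_not_ex => h; case/eqP: ne; apply/mnmP => i.
  by apply/eqP/negPn/negP/h.
pose i := [arg max_(i > i0 | m1 i != m2 i) val i].
have [hi hmax] : m1 i != m2 i /\ forall j : 'I_n, (i < j)%N -> m1 j = m2 j.
  rewrite /i; case: arg_maxnP => // {}i hi hm; split=> // j ij.
  by apply/eqP/negPn/negP => /hm /=; rewrite leqNgt ij.
have [lt|lt|ei] := ltngtP (m1 i) (m2 i); last by rewrite ei eqxx in hi.
- right; apply/grevlex_ltP; right; split=> //.
  by exists i => // j /hmax.
- by left; apply/grevlex_ltP; right; split=> //; exists i.
Qed.

Lemma grevlex_add2l m m1 m2 :
  grevlex_lt (m + m1)%MM (m + m2)%MM = grevlex_lt m1 m2.
Proof.
rewrite /grevlex_lt !mdegD ltn_add2l eqn_add2l; congr (_ || _ && _).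
apply: eq_existsb => i; rewrite !mnmDE ltn_add2l; congr (_ && _).
by apply: eq_forallb => j; rewrite !mnmDE eqn_add2l.
Qed.

Lemma grevlex_ind (Q : 'X_{1..n} -> Prop) :
  (forall m, (forall m', grevlex_lt m' m -> Q m') -> Q m) -> forall m, Q m.
Proof.
move=> step m.
(* Only finitely many monomials lie below [m], all of degree at most its own. *)
pose below d m := [pred x : 'X_{1..n < d} | grevlex_lt x m].
suff rec d : forall N m, (mdeg m < d)%N -> (#|below d m| < N)%N -> Q m.
  exact: (rec (mdeg m).+1 _ m).
elim=> // N IH {}m md cN; apply: step => m' lt.
have m'd : (mdeg m' < d)%N.
  apply: leq_ltn_trans md.
  by case/grevlex_ltP: lt => [/ltnW|[->]].
apply: IH => //; rewrite -ltnS; apply: leq_trans cN; rewrite ltnS.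
apply: proper_card; apply/properP; split.
  by apply/subsetP => x; rewrite !inE => /grevlex_trans; apply.
by exists (BMultinom m'd); rewrite !inE // grevlex_irr.
Qed.

End Grevlex.

(** * Initial monomials *)

Section Initial.
Variables (n : nat) (k : fieldType).
Implicit Types (f g : {mpoly k[n]}) (m : 'X_{1..n}).

Lemma mem_msuppM f g m : m \in msupp (f * g) ->
  exists m1 m2, [/\ m1 \in msupp f, m2 \in msupp g & m = (m1 + m2)%MM].
Proof. by move=> /msuppM_le/allpairsP[[m1 m2] /= [h1 h2 ->]]; exists m1, m2. Qed.

Lemma mem_msuppD f g m : m \in msupp (f + g) -> m \in msupp f \/ m \in msupp g.
Proof. by move=> /msuppD_le; rewrite mem_cat => /orP. Qed.

Lemma mem_msupp_sum (T : eqType) (s : seq T) (F : T -> {mpoly k[n]}) m :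
  m \in msupp (\sum_(x <- s) F x) -> exists2 x, x \in s & m \in msupp (F x).
Proof.
elim: s => [|x s IH]; first by rewrite big_nil msupp0.
rewrite big_cons => /mem_msuppD[h|/IH[y ys h]].
  by exists x; rewrite ?mem_head.
by exists y; rewrite // in_cons ys orbT.
Qed.

Lemma is_initial_exists f : f != 0 -> exists m, is_initial f m.
Proof.
rewrite -msupp_eq0 => f0.
suff [m ms hm] : exists2 m, m \in msupp f &
    forall m', m' \in msupp f -> m' != m -> grevlex_lt m' m by exists m.
elim: (msupp f) f0 => // m s IH _.
have [->|s0] := eqVneq s [::].
  by exists m; rewrite ?mem_head // => m'; rewrite inE => /eqP ->; rewrite eqxx.
have [m1 m1s h1] := IH s0.
have [lt|ge] := boolP (grevlex_lt m1 m).
  exists m; rewrite ?mem_head // => m'; rewrite inE => /predU1P[->|m's _].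
    by rewrite eqxx.
  by have [->//|/(h1 _ m's)/grevlex_trans] := eqVneq m' m1; apply.
exists m1; first by rewrite in_cons m1s orbT.
move=> m'; rewrite inE => /predU1P[-> /grevlex_total[//|]|]; last exact: h1.
by rewrite (negbTE ge).
Qed.

Lemma is_initial_unique f m m' : is_initial f m -> is_initial f m' -> m = m'.
Proof.
case=> ms hm [m's hm']; apply/eqP/negPn/negP => ne.
have := grevlex_trans (hm' _ ms ne); rewrite eq_sym in ne.
by move=> /(_ _ (hm _ m's ne)); rewrite grevlex_irr.
Qed.

Lemma is_initial_mul f g m m' :
  is_initial f m -> is_initial g m' -> is_initial (f * g) (m + m')%MM.
Proof.
move=> [mf hf] [mg hg].
have lt a b : a \in msupp f -> b \in msupp g -> (a, b) != (m, m') ->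
    grevlex_lt (a + b)%MM (m + m')%MM.
  move=> af bg; have [->|am] := eqVneq a m.
    by rewrite xpair_eqE eqxx grevlex_add2l; apply: hg.
  move=> _; have [->|bm] := eqVneq b m'.
    by rewrite ![(_ + m')%MM]addmC grevlex_add2l; apply: hf.
  apply: (@grevlex_trans _ (m + b)%MM); last by rewrite grevlex_add2l; apply: hg.
  by rewrite ![(_ + b)%MM]addmC grevlex_add2l; apply: hf.
split; last first.
  move=> c /mem_msuppM[a [b [af bg ->]]] ne; apply: lt => //.
  by apply: contra ne => /eqP[-> ->].
rewrite mcoeff_msupp.
have -> : f * g = f@_m *: (g * 'X_[m]) + (f - f@_m *: 'X_[m]) * g.
  by rewrite mulrBl -scalerAl (mulrC g) addrC subrK.
rewrite mcoeffD mcoeffZ mcoeffMX [X in _ + X]memN_msupp_eq0 ?addr0.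
  by rewrite mulf_neq0 // -mcoeff_msupp.
apply/negP => /mem_msuppM[a [b [af bg e]]].
have am : a != m.
  apply: contraTneq af => ->.
  by rewrite mcoeff_msupp mcoeffB mcoeffZ mcoeffX eqxx mulr1 subrr eqxx.
have {}af : a \in msupp f.
  move: af; rewrite !mcoeff_msupp mcoeffB mcoeffZ mcoeffX [m == a]eq_sym (negbTE am).
  by rewrite mulr0 subr0.
have := lt a b af bg; rewrite xpair_eqE (negbTE am) -e grevlex_irr.
by move=> /(_ isT).
Qed.

Lemma is_initial_X m : is_initial ('X_[m] : {mpoly k[n]}) m.
Proof.
split=> [|m']; first exact/mem_msuppXP.
by move=> /mem_msuppXP ->; rewrite eqxx.
Qed.

Lemma mcoeff_pihomog f d m :
  (pihomog mdeg d f)@_m = if mdeg m == d then f@_m else 0.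
Proof.
rewrite pihomogE raddf_sum /= big_mkcond /= [in RHS](mpolyE f) raddf_sum /=.
have [md|md] := eqVneq (mdeg m) d.
  apply: eq_bigr => a _; rewrite mcoeffZ mcoeffX.
  by case: (a =P m) => [->|_]; rewrite ?md ?eqxx ?mulr0 // if_same.
rewrite big1 // => a _; rewrite mcoeffZ mcoeffX.
by case: (a =P m) => [->|_]; rewrite ?(negbTE md) ?mulr0 // if_same.
Qed.

End Initial.

(** * Generated ideals and monomial ideals *)

Section GeneralIdeals.
Variable R : comNzRingType.
Implicit Types (I G : R -> Prop).

Lemma ideal_opp I a : is_ideal I -> I a -> I (- a).
Proof. by case=> _ _ hM /(hM (-1)); rewrite mulN1r. Qed.

Lemma ideal_sub I a b : is_ideal I -> I a -> I b -> I (a - b).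
Proof.
by move=> idI ha hb; case: (idI) => _ hD _; apply: hD => //; apply: ideal_opp.
Qed.

Lemma ideal_sum I (T : eqType) (s : seq T) (F : T -> R) :
  is_ideal I -> (forall x, x \in s -> I (F x)) -> I (\sum_(x <- s) F x).
Proof.
case=> h0 hD _; elim: s => [|x s IH] h; first by rewrite big_nil.
rewrite big_cons; apply: hD; first by apply: h; rewrite mem_head.
by apply: IH => y ys; apply: h; rewrite in_cons ys orbT.
Qed.

Lemma is_ideal_gen G : is_ideal (ideal_gen G).
Proof.
split.
- by exists [::]; rewrite ?big_nil.
- move=> a b [s hs ->] [t ht ->]; exists (s ++ t); last by rewrite big_cat.
  by move=> p; rewrite mem_cat => /orP[/hs|/ht].
- move=> c a [s hs ->]; exists [seq (c * p.1, p.2) | p <- s].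
    by move=> p /mapP[q /hs hq ->].
  by rewrite big_map mulr_sumr; apply: eq_bigr => p _; rewrite mulrA.
Qed.

Lemma mem_ideal_gen G g : G g -> ideal_gen G g.
Proof.
move=> Gg; exists [:: (1, g)]; last by rewrite big_seq1 mul1r.
by move=> p; rewrite inE => /eqP ->.
Qed.

Lemma ideal_gen_sub G I f : is_ideal I -> (forall g, G g -> I g) ->
  ideal_gen G f -> I f.
Proof.
move=> idI h [s hs ->]; apply: ideal_sum => // p ps.
by case: (idI) => _ _ hM; apply/hM/h/hs.
Qed.

End GeneralIdeals.

Section Ideals.
Variables (n : nat) (k : fieldType).
Implicit Types (f g : {mpoly k[n]}) (m : 'X_{1..n}).

(** Cancellation in a sum of multiples cannot create a monomial that no
    generator divides. *)
Lemma ideal_gen_msupp (G : {mpoly k[n]} -> Prop) f m :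
  ideal_gen G f -> m \in msupp f ->
  exists g m0, [/\ G g, m0 \in msupp g & (m0 <= m)%MM].
Proof.
case=> s hs -> /mem_msupp_sum[p /hs Gp /mem_msuppM[a [b [_ bp ->]]]].
by exists p.2, b; rewrite lem_addl.
Qed.

Lemma ideal_monomial_le (I : {mpoly k[n]} -> Prop) m m' :
  is_ideal I -> (m <= m')%MM -> I 'X_[m] -> I 'X_[m'].
Proof. by case=> _ _ hM le hm; rewrite -(submK le) mpolyXD; apply: hM. Qed.

Lemma ideal_of_monomials (I : {mpoly k[n]} -> Prop) f :
  is_ideal I -> (forall m, m \in msupp f -> I 'X_[m]) -> I f.
Proof.
move=> idI h; rewrite [f]mpolyE; apply: ideal_sum => // m /h.
by case: idI => _ _ hM /(hM (f@_m)%:MP); rewrite mul_mpolyC.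
Qed.

Lemma initial_ideal_monomialP (I : {mpoly k[n]} -> Prop) m :
  is_ideal I ->
  initial_ideal I 'X_[m] <-> exists2 f, I f & is_initial f m.
Proof.
move=> idI; split=> [h|[f If inf]]; last first.
  apply: mem_ideal_gen; exists f, m; split=> //.
  by apply: contraTneq (proj1 inf) => ->; rewrite msupp0.
have [_ [_ [[f [m0 [If _ inf ->]]] /mem_msuppXP <- le]]] :=
  ideal_gen_msupp h (proj1 (is_initial_X k m)).
exists ('X_[(m - m0)%MM] * f); first by case: idI => _ _ hM; apply: hM.
by rewrite -{2}(submK le); apply: is_initial_mul => //; apply: is_initial_X.
Qed.

Lemma initial_ideal_msupp (I : {mpoly k[n]} -> Prop) f m :
  initial_ideal I f -> m \in msupp f -> initial_ideal I 'X_[m].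
Proof.
move=> h /(ideal_gen_msupp h)[g [m0 [Gg m0g le]]].
apply: (ideal_monomial_le (is_ideal_gen _) le).
case: (Gg) => [f1 [m1 [_ _ _ e]]]; move: m0g; rewrite e => /mem_msuppXP <-.
by apply: mem_ideal_gen; rewrite -e.
Qed.

(** * Reduction modulo an ideal *)

(** Division by elements of [I] whose initial monomial satisfies [Bad]; the other
    initial monomials of [I] are left alone. *)
Section Reduction.
Variables (I : {mpoly k[n]} -> Prop) (Bad : 'X_{1..n} -> Prop).
Hypothesis idI : is_ideal I.
Hypothesis Bad_initial : forall m, Bad m -> exists2 f, I f & is_initial f m.

Definition reduced f := forall m, m \in msupp f -> ~ Bad m.

Lemma reduce_below m f :
  (forall a, grevlex_lt a m -> exists2 g, I ('X_[a] - g) &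
     reduced g /\ forall b, b \in msupp g -> grevlex_lt b m) ->
  (forall a, a \in msupp f -> grevlex_lt a m) ->
  exists2 g, I (f - g) & reduced g /\ forall b, b \in msupp g -> grevlex_lt b m.
Proof.
move=> nf; rewrite {2}[f]mpolyE; elim: (msupp f) => [|a s IH] lt.
  rewrite big_nil; exists 0; first by rewrite subrr; case: idI.
  by split=> b; rewrite msupp0.
have [g1 Ig1 [red1 lt1]] := nf a (lt a (mem_head _ _)).
have [|g2 Ig2 [red2 lt2]] := IH.
  by move=> b bs; apply: lt; rewrite in_cons bs orbT.
have [_ ID IM] := idI.
rewrite big_cons; exists (f@_a *: g1 + g2).
  rewrite opprD addrACA -scalerBr -mul_mpolyC.
  by apply: ID => //; apply: IM.
by split=> b /mem_msuppD[/msuppZ_le|]; auto.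
Qed.

Lemma msupp_sub_initial f m a : is_initial f m ->
  a \in msupp (f - f@_m *: 'X_[m]) -> grevlex_lt a m.
Proof.
move=> [_ lt]; have [->|am] := eqVneq a m.
  by rewrite mcoeff_msupp mcoeffB mcoeffZ mcoeffX eqxx mulr1 subrr eqxx.
rewrite mcoeff_msupp mcoeffB mcoeffZ mcoeffX [m == a]eq_sym (negbTE am) mulr0 subr0.
by rewrite -mcoeff_msupp => /lt; apply.
Qed.

Lemma reduce_monomial m : exists2 g, I ('X_[m] - g) &
  reduced g /\ forall b, b \in msupp g -> b = m \/ grevlex_lt b m.
Proof.
elim/grevlex_ind: m => m IH.
have [bad|good] := classic (Bad m); last first.
  exists 'X_[m]; first by rewrite subrr; case: idI.
  by split=> b /mem_msuppXP <- //; left.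
have [f If inf] := Bad_initial bad.
have [|a alt|g Ig [red lt]] := @reduce_below m (f - f@_m *: 'X_[m]).
- move=> a alt; have [g Ig [red lt]] := IH a alt; exists g => //; split=> // b.
  by move=> /lt[->//|/grevlex_trans]; apply.
- exact: msupp_sub_initial alt.
have c0 : f@_m != 0 by rewrite -mcoeff_msupp; case: inf.
exists (- (f@_m)^-1 *: g); last first.
  by split=> b /msuppZ_le; [apply: red | right; apply: lt].
have -> : 'X_[m] - - (f@_m)^-1 *: g =
    ((f@_m)^-1)%:MP * (f - (f - f@_m *: 'X_[m] - g)).
  rewrite !opprB [f + _]addrC -addrA subrK mul_mpolyC scalerDr scalerA mulVf //.
  by rewrite scale1r scaleNr opprK addrC.
by case: (idI) => _ _ IM; apply: IM; apply: ideal_sub.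
Qed.

(** Only the part of [f] below [m] gets reduced, so [m] stays the initial
    monomial. *)
Lemma reduce_initial f m : I f -> is_initial f m -> ~ Bad m ->
  exists2 g, I g & is_initial g m /\ reduced g.
Proof.
move=> If inf good.
have [|a alt|g Ig [red lt]] := @reduce_below m (f - f@_m *: 'X_[m]).
- move=> a alt; have [g Ig [red lt]] := reduce_monomial a.
  exists g => //; split=> // b.
  by move=> /lt[->//|/grevlex_trans]; apply.
- exact: msupp_sub_initial alt.
exists (f - (f - f@_m *: 'X_[m] - g)); first exact: ideal_sub.
rewrite [X in is_initial X _ /\ reduced X](_ : _ = f@_m *: 'X_[m] + g); last first.
  by rewrite !opprB [f + _]addrC -addrA subrK addrC.
split; last first.
  by move=> b /mem_msuppD[/msuppZ_le/mem_msuppXP <-|/red].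
have gm : m \notin msupp g by apply/negP => /lt; rewrite grevlex_irr.
split=> [|b /mem_msuppD[/msuppZ_le/mem_msuppXP <-|/lt//]]; last by rewrite eqxx.
rewrite mcoeff_msupp mcoeffD mcoeffZ mcoeffX eqxx mulr1 (memN_msupp_eq0 gm) addr0.
by rewrite -mcoeff_msupp; case: inf.
Qed.

End Reduction.
End Ideals.

(** * Coefficients over the last variables *)

Lemma mpoly_mul_eqC (R : idomainType) (n : nat) (p q : {mpoly R[n]}) (a : R) :
  p * q = a%:MP -> a != 0 -> exists b, p = b%:MP.
Proof.
move=> e a0; have [p0 q0] : p != 0 /\ q != 0.
  by apply/andP; rewrite -negb_or -mulf_eq0 e mpolyC_eq0.
have := msizeM p0 q0; rewrite e msizeC a0.
rewrite (mpolySpred _ p0) (mpolySpred _ q0) addSn addnS /= => -[/esym/eqP].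
rewrite addn_eq0 => /andP[/eqP sp _].
by exists p@_0; apply: msize1_polyC; rewrite (mpolySpred _ p0) sp.
Qed.

(** A polynomial seen as one in the first [r] variables with coefficients in the
    last ones.  Both kinds of variables keep their indices in ['I_n], so that a
    monomial [m] is just [Psi m + Phi r m]. *)
HB.lock Definition coefs_over_last (n r : nat) (k : fieldType) :
    {mpoly k[n]} -> {mpoly {mpoly k[n]}[n]} :=
  mmap (@mpolyC n {mpoly k[n]} \o @mpolyC n k)
       (fun i : 'I_n => if (i < r)%N then 'X_i else ('X_i)%:MP).
Canonical coefs_over_last_unlockable := Unlockable coefs_over_last.unlock.

Section CoefficientsOverLast.
Variables (n r : nat) (k : fieldType).
Local Notation S := {mpoly k[n]}.
Implicit Types (f g c : S) (m w y : 'X_{1..n}).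

Definition Psi m : 'X_{1..n} := (m - Phi r m)%MM.

Lemma PhiE m i : Phi r m i = if (i < r)%N then m i else 0%N.
Proof. exact: mnmE. Qed.

Lemma PsiE m i : Psi m i = if (i < r)%N then 0%N else m i.
Proof. by rewrite mnmBE PhiE; case: ifP; rewrite ?subnn ?subn0. Qed.

Lemma Phi_le m : (Phi r m <= m)%MM.
Proof. by apply/mnm_lepP => i; rewrite PhiE; case: ifP. Qed.

Lemma Psi_Phi m : (Psi m + Phi r m)%MM = m.
Proof. exact/submK/Phi_le. Qed.

Lemma PhiD m w : Phi r (m + w)%MM = (Phi r m + Phi r w)%MM.
Proof. by apply/mnmP => i; rewrite mnmDE !PhiE mnmDE; case: (i < r)%N. Qed.

Lemma Phi_idem m : Phi r (Phi r m) = Phi r m.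
Proof. by apply/mnmP => i; rewrite !PhiE; case: (i < r)%N. Qed.

Lemma Phi_id m : mnm_in_first r m -> Phi r m = m.
Proof.
by move=> h; apply/mnmP => i; rewrite PhiE; case: ltnP => // /h ->.
Qed.

Lemma Phi_first m : mnm_in_first r (Phi r m).
Proof. by move=> i ri; rewrite PhiE ltnNge ri. Qed.

Lemma coefs_over_last_is_additive : additive (@coefs_over_last n r k).
Proof. by rewrite unlock => f g; rewrite raddfB. Qed.

Lemma coefs_over_last_is_multiplicative :
  multiplicative (@coefs_over_last n r k).
Proof. by rewrite unlock; split=> [f g|]; rewrite ?rmorphM ?rmorph1. Qed.

HB.instance Definition _ :=
  GRing.isAdditive.Build S {mpoly S[n]} (@coefs_over_last n r k)
    coefs_over_last_is_additive.
HB.instance Definition _ :=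
  GRing.isMultiplicative.Build S {mpoly S[n]} (@coefs_over_last n r k)
    coefs_over_last_is_multiplicative.

Local Notation theta := (@coefs_over_last n r k).

Lemma coefs_over_lastC (a : k) : theta a%:MP = a%:MP%:MP.
Proof. by rewrite unlock mmapC. Qed.

Lemma coefs_over_lastXU (i : 'I_n) :
  theta 'X_i = if (i < r)%N then 'X_i else ('X_i)%:MP.
Proof. by rewrite unlock mmapX mmap1U. Qed.

Lemma coefs_over_lastX m : theta 'X_[m] = ('X_[Psi m])%:MP * 'X_[Phi r m].
Proof.
rewrite unlock mmapX /mmap1 [X in _ = X%:MP * _]mpolyXE_id.
rewrite [X in _ = _ * X]mpolyXE_id rmorph_prod -big_split /=.
apply: eq_bigr => i _; rewrite rmorphXn /= PhiE PsiE.
by case: ifP; rewrite expr0 ?mul1r ?mulr1.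
Qed.

Lemma mcoeff_coefs_over_last f w : (theta f)@_w =
  \sum_(m <- msupp f) f@_m *: (if Phi r m == w then 'X_[Psi m] else 0).
Proof.
rewrite {1}[f]mpolyE rmorph_sum /= raddf_sum /=; apply: eq_bigr => m _.
rewrite -mul_mpolyC rmorphM /= coefs_over_lastC mcoeffCM coefs_over_lastX.
rewrite mcoeffCM mcoeffX mul_mpolyC; case: eqP => _; last by rewrite mulr0.
by rewrite mulr1.
Qed.

Lemma mcoeff2_coefs_over_last f m : (theta f)@_(Phi r m)@_(Psi m) = f@_m.
Proof.
rewrite mcoeff_coefs_over_last raddf_sum /=.
have E a : (f@_a *: (if Phi r a == Phi r m then 'X_[Psi a] else 0))@_(Psi m) =
    f@_a * (a == m)%:R.
  rewrite mcoeffZ; case: eqP => [ePhi|nPhi].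
    rewrite mcoeffX -(eqm_add2r (Phi r m) (Psi a)).
    by rewrite -{1}ePhi !Psi_Phi.
  rewrite mcoeff0; case: eqP => // eam; by rewrite eam in nPhi.
rewrite (eq_bigr _ (fun a _ => E a)) [X in _ = X@_m]mpolyE raddf_sum /=.
by apply: eq_bigr => a _; rewrite mcoeffZ mcoeffX.
Qed.

Lemma msupp_coefs_over_last f w y : y \in msupp (theta f)@_w ->
  exists2 m, m \in msupp f & Phi r m = w /\ Psi m = y.
Proof.
rewrite mcoeff_coefs_over_last => /mem_msupp_sum[m mf].
move=> /msuppZ_le; case: eqP => [e /mem_msuppXP <-|_]; last by rewrite msupp0.
by exists m.
Qed.

Lemma mem_msupp_coefs f m : m \in msupp f -> (theta f)@_(Phi r m) != 0.
Proof.
rewrite mcoeff_msupp -mcoeff2_coefs_over_last; apply: contraNneq => ->.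
by rewrite mcoeff0.
Qed.

Definition in_last c := forall m, m \in msupp c -> Phi r m = 0%MM.

Lemma in_lastP c : in_last c <-> theta c = c%:MP.
Proof.
split=> [h|e m mc]; last first.
  have := mem_msupp_coefs mc; rewrite e mcoeffC.
  by case: (Phi r m =P 0%MM) => //; rewrite mulr0 eqxx.
rewrite {1 2}[c]mpolyE !rmorph_sum /= big_seq [RHS]big_seq.
apply: eq_bigr => m /h e.
rewrite -!mul_mpolyC !rmorphM /= coefs_over_lastC coefs_over_lastX e mpolyX0 mulr1.
by rewrite -[in LHS](addm0 (Psi m)) -{1}e Psi_Phi.
Qed.

Lemma mcoeff_in_lastM c f w : in_last c ->
  (theta (c * f))@_w = c * (theta f)@_w.
Proof. by move=> /in_lastP e; rewrite rmorphM /= e mcoeffCM. Qed.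

Lemma in_last_coef f w : in_last (theta f)@_w.
Proof.
move=> y /msupp_coefs_over_last[m _ [_ <-]].
by apply/mnmP => i; rewrite PhiE PsiE mnm0E; case: (i < r)%N.
Qed.

(** Degrees in the first [r] variables add up, so a factor of a polynomial of
    degree 0 in them has degree 0. *)
Lemma in_last_mulr_inv c f : in_last (c * f) -> c * f != 0 -> in_last c.
Proof.
move=> /in_lastP; rewrite rmorphM /= => e cf0.
have [d ed] := mpoly_mul_eqC e cf0.
move=> m /mem_msupp_coefs; rewrite ed mcoeffC.
by case: (Phi r m =P 0%MM) => //; rewrite mulr0 eqxx.
Qed.

End CoefficientsOverLast.

(** * The rank-one module of reduced elements *)

Lemma exists_min (T : Type) (mu : T -> nat) (Q : T -> Prop) :
  (exists x, Q x) -> exists2 x, Q x & forall y, Q y -> (mu x <= mu y)%N.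
Proof.
case=> x; have [N] := ubnP (mu x); elim: N x => // N IH x muN Qx.
have [[y [Qy lt]]|nlt] := classic (exists y, Q y /\ (mu y < mu x)%N).
  by apply: (IH y) => //; apply: leq_trans lt _; rewrite -ltnS.
exists x => // y Qy; rewrite leqNgt; apply/negP => lt.
by apply: nlt; exists y.
Qed.

(** [P] is a prime ideal with initial ideal [J], and [ubar] is the only monomial
    in the first [r] variables that [J] gains when the last ones are inverted. *)
Section PrimeWithSocleInitialIdeal.
Variables (n r : nat) (k : fieldType).
Local Notation S := {mpoly k[n]}.
Local Notation theta := (@coefs_over_last n r k).
Variables (P J : S -> Prop) (ubar : 'X_{1..n}).
Hypothesis primeP : is_prime_ideal P.
Hypothesis idJ : is_ideal J.
Hypothesis initialJ :
  forall m, J 'X_[m] <-> exists2 f, P f & is_initial f m.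
Hypothesis Phi_ubar : Phi r ubar = ubar.
Hypothesis ubar_notin : ~ J 'X_[ubar].
Hypothesis Phi_dichotomy :
  forall m, J 'X_[m] -> J 'X_[Phi r m] \/ Phi r m = ubar.
Implicit Types (f g c : S) (m w : 'X_{1..n}).

Definition Phi_mem m : Prop := J 'X_[Phi r m].

Let idP : is_ideal P. Proof. by case: primeP. Qed.

(** In the notation of the introduction: [f] lies in W. *)
Lemma reducedP f : reduced Phi_mem f <-> forall w, J 'X_[w] ->
  Phi r w = w -> (theta f)@_w = 0.
Proof.
split=> [red w Jw ew|h m mf bad].
  apply/eqP; rewrite -msupp_eq0.
  case E : (msupp _) => [//|y s]; have : y \in msupp (theta f)@_w.
    by rewrite E mem_head.
  by move=> /msupp_coefs_over_last[m /red bad [e _]]; case: bad; rewrite /Phi_mem e.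
have := mem_msupp_coefs r mf; rewrite h ?eqxx //; exact: Phi_idem.
Qed.

Lemma reduced_initial f : P f -> reduced Phi_mem f -> f != 0 ->
  exists2 m, is_initial f m & Phi r m = ubar.
Proof.
move=> Pf red /is_initial_exists[m inf]; exists m => //.
have Jm : J 'X_[m] by apply/initialJ; exists f.
by have [bad|//] := Phi_dichotomy Jm; case: (red m (proj1 inf) bad).
Qed.

(** A reduced element of [P] has its initial monomial in the [ubar]-component. *)
Lemma reduced_coef_eq0 f : P f -> reduced Phi_mem f ->
  (theta f)@_ubar = 0 -> f = 0.
Proof.
move=> Pf red e; apply/eqP/negPn/negP => f0.
have [m [mf _] em] := reduced_initial Pf red f0.
by have := mem_msupp_coefs r mf; rewrite em e eqxx.
Qed.

Lemma exists_reduced m : J 'X_[m] -> Phi r m = ubar ->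
  exists2 f, P f & is_initial f m /\ reduced Phi_mem f.
Proof.
move=> /initialJ[f Pf inf] em.
apply: (reduce_initial idP _ Pf inf); last by rewrite /Phi_mem em.
move=> a bad; apply/initialJ.
exact: (ideal_monomial_le idJ (Phi_le r a)).
Qed.

Hypothesis ubar_neq0 : ubar != 0%MM.

(** [c] is reduced: its monomials have first part 1, and 1 is not in [J].  So a
    nonzero [c] in [P] would have an initial monomial with first part [ubar]. *)
Lemma in_last_notin c : in_last r c -> c != 0 -> ~ P c.
Proof.
move=> lc c0 Pc.
have red : reduced Phi_mem c.
  move=> m /lc; rewrite /Phi_mem => ->; rewrite mpolyX0 => J1.
  by apply: ubar_notin; case: idJ => _ _ /(_ 'X_[ubar] _ J1); rewrite mulr1.
have [m [/lc -> _] e] := reduced_initial Pc red c0.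
by case/eqP: ubar_neq0.
Qed.

(** A reflexive module of rank one over a factorial ring is free. *)
Lemma reduced_generator : (exists2 m, J 'X_[m] & Phi r m = ubar) ->
  exists g m, [/\ is_initial g m, P g, reduced Phi_mem g, Phi r m = ubar &
    forall f, P f -> reduced Phi_mem f -> exists q, f = q * g].
Proof.
case=> m0 Jm0 em0; have [f0 Pf0 [inf0 redf0]] := exists_reduced Jm0 em0.
have [|g [Pg redg g0] ming] := exists_min (fun g => msize (theta g)@_ubar)
    (Q := fun g => [/\ P g, reduced Phi_mem g & g != 0]).
  exists f0; split=> //; apply: contraTneq (proj1 inf0) => ->.
  by rewrite msupp0.
have [m ing em] := reduced_initial Pg redg g0.
exists g, m; split=> // f Pf redf.
pose b := (theta g)@_ubar.
have {}ming h : P h -> reduced Phi_mem h -> h != 0 ->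
    (msize b <= msize (theta h)@_ubar)%N.
  by move=> Ph redh h0; apply: (ming h).
have lb : in_last r b by apply: in_last_coef.
have b0 : b != 0.
  by apply: contraNneq g0 => e; apply/eqP/reduced_coef_eq0.
have [_ _ MP] := idP; have [_ _ prP] := primeP.
pose d := (theta f)@_ubar.
have ld : in_last r d by apply: in_last_coef.
(* Both relations lie in a module of rank one, hence are proportional. *)
have cross : d * g = b * f.
  apply/eqP; rewrite -subr_eq0; apply/eqP/reduced_coef_eq0.
  - by apply: ideal_sub => //; apply: MP.
  - apply/reducedP => w Jw ew; rewrite rmorphB mcoeffB !mcoeff_in_lastM //.
    move/reducedP: redg => ->//; move/reducedP: redf => ->//.
    by rewrite !mulr0 subrr.
  - by rewrite rmorphB mcoeffB !mcoeff_in_lastM // mulrC subrr.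
(* By minimality no prime factor of [b] divides [g], so all divide [d]. *)
have strip c : prime_product c -> divides c b ->
    forall d' f', d' * g = c * f' -> divides c d'.
  elim=> [a ua _ d' f' _ | p a [p0 pu pr] pa IH [b' eb] d' f' e].
    by exists (a^-1 * d'); rewrite mulrA divrr // mul1r.
  have lp : in_last r p.
    by apply: (@in_last_mulr_inv _ _ _ _ (a * b')); rewrite mulrA -eb.
  have [[d1 ed]|[g1 eg]] : divides p d' \/ divides p g.
  - by apply: pr; exists (a * f'); rewrite e mulrA.
  - have [||x ex] := IH _ d1 f'; last by exists x; rewrite ed ex mulrA.
      by exists (p * b'); rewrite mulrCA mulrA.
    by apply: (mulfI p0); rewrite mulrA -ed e mulrA.
  - exfalso.
    have g10 : g1 != 0 by apply: contraNneq g0 => e1; rewrite eg e1 mulr0.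
    have Pg1 : P g1.
      have [/(in_last_notin lp p0)//|//] : P p \/ P g1 by apply: prP; rewrite -eg.
    have redg1 : reduced Phi_mem g1.
      apply/reducedP => w Jw ew; apply: (mulfI p0).
      rewrite -mcoeff_in_lastM // -eg mulr0.
      by move/reducedP: redg => ->.
    have := ming g1 Pg1 redg1 g10; rewrite leqNgt => /negP; apply.
    rewrite /b eg mcoeff_in_lastM //; apply: msize_ltM => //.
    apply: contraNneq b0 => e1.
    by rewrite /b eg mcoeff_in_lastM // e1 mulr0.
have dbb : divides b b by exists 1; rewrite mulr1.
have [q ed] := strip b (factorial_domain_mpoly b0) dbb d f cross.
by exists q; apply: (mulfI b0); rewrite -cross ed mulrA.
Qed.

Lemma least_initial_monomial : (exists2 m, J 'X_[m] & Phi r m = ubar) ->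
  exists m0, [/\ J 'X_[m0], Phi r m0 = ubar &
    forall m, J 'X_[m] -> Phi r m = ubar -> (m0 <= m)%MM].
Proof.
move=> /reduced_generator[g [m0 [ing Pg redg em0 gen]]].
exists m0; split=> // [|m Jm em]; first by apply/initialJ; exists g.
have [f Pf [inf redf]] := exists_reduced Jm em.
have [q ef] := gen f Pf redf.
have q0 : q != 0.
  by apply: contraTneq (proj1 inf) => q0; rewrite ef q0 mul0r msupp0.
have [a inq] := is_initial_exists q0.
have -> : m = (a + m0)%MM.
  by apply: (is_initial_unique inf); rewrite ef; apply: is_initial_mul.
exact: lem_addl.
Qed.

End PrimeWithSocleInitialIdeal.

(** * Nonvanishing over an infinite field *)

Section NonVanishing.
Variable k : fieldType.
Hypothesis hk : infinite_field k.

Lemma infinite_field_nonroot (p : {poly k}) : p != 0 -> exists x, ~~ root p x.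
Proof.
move=> p0; apply: NNPP => none.
have all_roots x : root p x by apply/negPn/negP => h; apply: none; exists x.
have [s us es] : exists2 s : seq k, uniq s & size s = size p.
  elim: (size p) => [|N [s us es]]; first by exists [::].
  by have [x xs] := hk s; exists (x :: s); rewrite /= ?xs ?es.
have rs : all (root p) s by apply/allP => x _.
by have := max_poly_roots p0 rs us; rewrite es ltnn.
Qed.

Lemma infinite_field_nonvanishing (n : nat) (f : {mpoly k[n]}) :
  f != 0 -> exists v : 'I_n -> k, f.@[v] != 0.
Proof.
elim: n f => [|n IH] f f0.
  exists (fun _ => 0); rewrite [f]nvar0_mpolyC mevalC.
  by apply: contraNneq f0 => e; rewrite [f]nvar0_mpolyC e mpolyC0.
have uf0 : muni f != 0.
  by apply: contraNneq f0 => e; rewrite -[f]muniK e rmorph0.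
have [v hv] := IH (lead_coef (muni f)) (etrans (congr1 negb (lead_coef_eq0 _)) uf0).
have p0 : map_poly (meval v) (muni f) != 0.
  apply: contraNneq hv => e; apply/eqP.
  have := congr1 (fun p : {poly k} => p`_(size (muni f)).-1) e.
  by rewrite /= coef_map coef0.
have [x hx] := infinite_field_nonroot p0.
exists (fun i => if unlift ord_max i is Some j then v j else x).
move: hx; rewrite /root; congr (_ != 0).
apply: (mpoly_rmorphism_eq
  (f := horner_eval x \o map_poly (meval v) \o @muni n k)
  (g := meval (fun i => if unlift ord_max i is Some j then v j else x)))
  => [c|i] /=; rewrite /horner_eval.
  by rewrite muniC map_polyC /= hornerC !mevalC.
rewrite mevalXU; case: (unliftP ord_max i) => [j ->|->]; last first.
  by rewrite muniX_max map_polyX hornerX.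
have -> : lift ord_max j = widen_ord (leqnSn n) j.
  by apply: val_inj; rewrite /= /bump leqNgt ltn_ord.
by rewrite muniX_widen map_polyC /= hornerC mevalXU.
Qed.

End NonVanishing.

(** * Linear changes of coordinates *)

Section LinearChange.
Variables (n : nat) (k : fieldType).
Implicit Types (A B : 'M[k]_n) (f : {mpoly k[n]}) (P : {mpoly k[n]} -> Prop).

HB.instance Definition _ A := GRing.RMorphism.copy (@lin_change n k A)
  (comp_mpoly [tuple \sum_(i < n) A i j *: 'X_i | j < n]).

Lemma lin_changeC A (c : k) : lin_change A c%:MP = c%:MP.
Proof. exact: comp_mpolyC. Qed.

Lemma lin_changeXU A j : lin_change A 'X_j = \sum_(i < n) A i j *: 'X_i.
Proof. by rewrite /lin_change comp_mpolyXU -tnth_nth tnth_mktuple. Qed.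

Lemma lin_change_comp A B f :
  lin_change B (lin_change A f) = lin_change (B *m A) f.
Proof.
apply: (mpoly_rmorphism_eq (f := lin_change B \o lin_change A)
  (g := lin_change (B *m A))) => [c|j] /=; first by rewrite !lin_changeC.
rewrite !lin_changeXU rmorph_sum /=.
under eq_bigr => i _ do
  rewrite -mul_mpolyC rmorphM /= lin_changeC lin_changeXU mul_mpolyC scaler_sumr.
rewrite exchange_big; apply: eq_bigr => l _ /=.
rewrite mxE scaler_suml; apply: eq_bigr => i _.
by rewrite scalerA mulrC.
Qed.

Lemma lin_change1 f : lin_change 1%:M f = f.
Proof.
apply: (mpoly_rmorphism_eq (f := lin_change 1%:M) (g := idfun)) => [c|j] /=.
  exact: lin_changeC.
rewrite lin_changeXU (bigD1 j) //= mxE eqxx scale1r big1 ?addr0 // => i ij.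
by rewrite mxE (negbTE ij) scale0r.
Qed.

Lemma image_lin_changeP A P f : A \in unitmx ->
  image_ideal (lin_change A) P f <-> P (lin_change (invmx A) f).
Proof.
move=> uA; split=> [[g Pg ->]|Pf].
  by rewrite lin_change_comp mulVmx // lin_change1.
by exists (lin_change (invmx A) f); rewrite // lin_change_comp mulmxV // lin_change1.
Qed.

Lemma is_prime_ideal_lin_change A P : A \in unitmx ->
  is_prime_ideal P -> is_prime_ideal (image_ideal (lin_change A) P).
Proof.
move=> uA [[P0 PD PM] P1 Ppr]; split; first split.
- by apply/image_lin_changeP; rewrite // rmorph0.
- move=> a b /image_lin_changeP-/(_ uA) Pa /image_lin_changeP-/(_ uA) Pb.
  by apply/image_lin_changeP; rewrite // rmorphD; apply: PD.
- move=> c a /image_lin_changeP-/(_ uA) Pa.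
  by apply/image_lin_changeP; rewrite // rmorphM; apply: PM.
- by move=> /image_lin_changeP-/(_ uA); rewrite rmorph1.
- move=> a b /image_lin_changeP-/(_ uA); rewrite rmorphM => /Ppr[] h; [left|right];
  exact/image_lin_changeP.
Qed.

Lemma lin_change_dhomog A (m : 'X_{1..n}) :
  lin_change A 'X_[m] \is (mdeg m).-homog.
Proof.
rewrite mpolyXE_id rmorph_prod mdegE.
elim: (index_enum _) => [|i s IH]; first by rewrite !big_nil dhomog1.
rewrite !big_cons; apply: dhomogM => //; rewrite rmorphXn /=.
rewrite -[X in _ \is X.-homog]mul1n; apply: dhomogMn.
rewrite lin_changeXU; apply: rpred_sum => j _; apply: dhomogZ.
by rewrite dhomogX /= mdeg1.
Qed.

Lemma lin_change_mdeg_lt A f m :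
  m \in msupp (lin_change A f) -> (mdeg m < msize f)%N.
Proof.
rewrite {1}[f]mpolyE rmorph_sum /= => /mem_msupp_sum[a af].
rewrite -mul_mpolyC rmorphM /= lin_changeC mul_mpolyC => /msuppZ_le ma.
by rewrite (dhomog_mf (lin_change_dhomog A a) ma); apply: msize_mdeg_lt.
Qed.

End LinearChange.

(** * Generic shears of the last variables *)

(** The matrix of a change of coordinates that fixes the variables before [rho]
    multiplies [x_rho] by [l rho], and adds [l j * x_rho] to each later [x_j]. *)
Definition shear (n : nat) (R : comNzRingType) (rho : 'I_n) (l : 'I_n -> R) :
    'M[R]_n :=
  \matrix_(i, j) (if i == rho then if (j < rho)%N then 0 else l j
                  else (i == j)%:R).

Section Shear.
Variables (n : nat) (k : fieldType) (rho : 'I_n).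
Local Notation r := (nat_of_ord rho).
Implicit Types (l : 'I_n -> k) (f c : {mpoly k[n]}).

Lemma shear1 : shear rho (fun j => (j == rho)%:R) = 1%:M :> 'M[k]_n.
Proof.
apply/matrixP => i j; rewrite !mxE; case: (i =P rho) => // ->.
rewrite (eq_sym rho); case: ltnP => //.
by case: (j =P rho) => // ->; rewrite ltnn.
Qed.

Lemma map_shear (R : comNzRingType) (h : {rmorphism {mpoly k[n]} -> R}) v :
  map_mx h (shear rho v) = shear rho (fun j => h (v j)).
Proof.
apply/matrixP => i j; rewrite !mxE; case: ifP => _; last by rewrite rmorph_nat.
by case: ifP => _; rewrite ?rmorph0.
Qed.

(** The conditions on [l] are the nonvanishing of a determinant, of an equation
    of the open set, and of [h]; the first two hold at the identity. *)
Lemma generic_shear (U : 'M[k]_n -> Prop) A h :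
  infinite_field k -> zariski_open_GL U -> U A -> h != 0 ->
  exists l, [/\ U (shear rho l *m A), shear rho l \in unitmx & h.@[l] != 0].
Proof.
move=> hk [F openU] /openU[uA [f Ff fA]] h0.
pose M : 'M[{mpoly k[n]}]_n := shear rho (fun j => 'X_j).
pose q := f \mPo [tuple mxvec (M *m map_mx (@mpolyC n k) A) 0 i | i < n * n].
have evalM l : map_mx (meval l) M = shear rho l.
  by rewrite map_shear; apply/matrixP => i j; rewrite !mxE /= mevalXU.
have evalq l : q.@[l] = f.@[fun i => mxvec (shear rho l *m A) 0 i].
  rewrite comp_mpoly_meval; apply: meval_eq => i; rewrite tnth_mktuple.
  have -> : shear rho l *m A = map_mx (meval l) (M *m map_mx (@mpolyC n k) A).
    rewrite map_mxM evalM -map_mx_comp; congr (_ *m _).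
    by apply/matrixP => a b; rewrite !mxE /= mevalC.
  by rewrite -map_mxvec mxE.
pose l0 : 'I_n -> k := fun j => (j == rho)%:R.
have detM0 : \det M != 0.
  apply/eqP => /(congr1 (meval l0)); rewrite -det_map_mx evalM shear1 det1.
  by rewrite meval0 => /eqP; rewrite oner_eq0.
have q0 : q != 0.
  apply: contraNneq fA => /(congr1 (meval l0)); rewrite evalq shear1 mul1mx.
  by rewrite meval0 => ->.
have [|l] := infinite_field_nonvanishing hk (f := \det M * q * h).
  by rewrite !mulf_neq0.
rewrite !rmorphM /= -det_map_mx evalM evalq !mulf_eq0 !negb_or.
move=> /andP[/andP[dl ql] hl]; exists l.
have ul : shear rho l \in unitmx by rewrite unitmxE unitfE.
split=> //; apply/openU; rewrite unitmx_mul ul uA; split=> //.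
by exists f.
Qed.

Lemma shear_fixes l (i : 'I_n) : (i < r)%N -> lin_change (shear rho l) 'X_i = 'X_i.
Proof.
move=> ir; rewrite lin_changeXU (bigD1 i) //= mxE eqxx.
have -> : (i == rho) = false by apply: contraTF ir => /eqP ->; rewrite ltnn.
rewrite scale1r big1 ?addr0 // => j ji; rewrite mxE ir (negbTE ji).
by case: ifP; rewrite scale0r.
Qed.

Lemma shear_in_last l (i : 'I_n) : (r <= i)%N ->
  in_last r (lin_change (shear rho l) 'X_i).
Proof.
move=> ri m; rewrite lin_changeXU => /mem_msupp_sum[j _].
rewrite mcoeff_msupp mcoeffZ mcoeffX mxE.
case: (U_(j)%MM =P m) => [<- h|]; last by rewrite mulr0 eqxx.
have rj : (r <= j)%N.
  move: h; case: (j =P rho) => [-> //|_].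
  by case: (j =P i) => [->|]; rewrite ?mul0r ?eqxx.
apply/mnmP => a; rewrite PhiE mnm1E mnm0E; case: ltnP => // ar.
by case: (j =P a) => // e; move: ar; rewrite -e ltnNge rj.
Qed.

(** A shear acts on the last variables only, hence coefficientwise. *)
Lemma coefs_over_last_shear l f (w : 'X_{1..n}) :
  (coefs_over_last r (lin_change (shear rho l) f))@_w =
  lin_change (shear rho l) (coefs_over_last r f)@_w.
Proof.
rewrite -mcoeff_map_mpoly; congr (_ @_ w).
apply: (mpoly_rmorphism_eq
  (f := @coefs_over_last n r k \o lin_change (shear rho l))
  (g := map_mpoly (lin_change (shear rho l)) \o @coefs_over_last n r k))
  => [c|i] /=.
  by rewrite lin_changeC !coefs_over_lastC map_mpolyC /= lin_changeC.
rewrite coefs_over_lastXU; case: ltnP => ir.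
  by rewrite shear_fixes // coefs_over_lastXU ir map_mpolyX.
rewrite map_mpolyC; apply/in_lastP; exact: shear_in_last.
Qed.

(* Restriction to the [x_rho]-axis: a shear followed by this restriction sends
   each last variable [x_j] to [l j * x_rho]. *)
Local Notation axis :=
  (mmap (@polyC k) (fun i : 'I_n => if i == rho then 'X else 0)).

Lemma coef_axis f d : (axis f)`_d = f@_(U_(rho) *+ d).
Proof.
rewrite [in RHS](mpolyE f) /mmap coef_sum raddf_sum /=.
apply: eq_bigr => m _; rewrite coefCM mcoeffZ mcoeffX; congr (_ * _).
rewrite /mmap1 (bigD1 rho) //= eqxx.
have [[i ir mi]|h] := classic (exists2 i, i != rho & m i != 0%N).
  rewrite (bigD1 i) //= (negbTE ir) expr0n (negbTE mi) mul0r mulr0 coef0.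
  case: eqP => // e; move: mi; rewrite e mulmnE mnm1E [rho == i]eq_sym (negbTE ir).
  by rewrite mul0n eqxx.
have m0 i : i != rho -> m i = 0%N.
  by move=> ir; apply/eqP/negPn/negP => mi; apply: h; exists i.
rewrite big1 => [|i ir]; last by rewrite m0 // expr0.
rewrite mulr1 coefXn; congr (_%:R); congr nat_of_bool.
apply/eqP/eqP => [->|->]; last by rewrite mulmnE mnm1E eqxx mul1n.
apply/mnmP => i; rewrite mulmnE mnm1E [rho == i]eq_sym.
by case: (i =P rho) => [->|/eqP/m0 ->]; rewrite ?mul1n.
Qed.

Lemma axis_shear l c : in_last r c -> axis (lin_change (shear rho l) c) =
  \sum_(m <- msupp c) (c@_m * \prod_i l i ^+ m i) *: 'X^(mdeg m).
Proof.
move=> lc; rewrite {1}[c]mpolyE (rmorph_sum (lin_change (shear rho l))).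
rewrite raddf_sum big_seq [RHS]big_seq.
apply: eq_bigr => m /lc em.
rewrite -mul_mpolyC (rmorphM (lin_change (shear rho l))) /= lin_changeC.
rewrite rmorphM /= mmapC -scalerA -mul_polyC.
congr (_ * _); rewrite mpolyXE_id (rmorph_prod (lin_change (shear rho l))).
rewrite rmorph_prod /= mdegE.
rewrite -prodrXr -scaler_prod /=; apply: eq_bigr => i _.
rewrite (rmorphXn (lin_change (shear rho l))) rmorphXn /= -exprZn.
have [ir|ri] := ltnP i r.
  by have := congr1 (fun m' : 'X_{1..n} => m' i) em;
    rewrite /= PhiE ir mnm0E => ->.
congr (_ ^+ _); rewrite lin_changeXU rmorph_sum (bigD1 rho) //= big1 ?addr0.
  rewrite mmapZ mmapX mmap1U eqxx mxE eqxx ltnNge ri /=.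
  by rewrite mul_polyC.
by move=> j jr; rewrite mmapZ mmapX mmap1U (negbTE jr) mulr0.
Qed.

(** For generic [l] the degree-[d] part of [c] thus yields a power of [x_rho]. *)
Lemma mcoeff_shear_power l c d : in_last r c ->
  (lin_change (shear rho l) c)@_(U_(rho) *+ d) = (pihomog mdeg d c).@[l].
Proof.
move=> lc; rewrite -coef_axis axis_shear // coef_sum pihomogE raddf_sum /=.
rewrite [RHS]big_mkcond /=; apply: eq_bigr => m _.
rewrite coefZ coefXn eq_sym; case: eqP => _; last by rewrite mulr0.
by rewrite mulr1 mevalZ mevalX.
Qed.

End Shear.

(** * Powers of one variable in the generic initial ideal *)

Section GenericInitialIdeal.
Variables (n : nat) (k : fieldType) (rho : 'I_n).
Local Notation r := (nat_of_ord rho).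
Variables (P J : {mpoly k[n]} -> Prop) (U : 'M[k]_n -> Prop).
Hypothesis hk : infinite_field k.
Hypothesis primeP : is_prime_ideal P.
Hypothesis openU : zariski_open_GL U.
Hypothesis ginJ : forall A, U A ->
  same_ideal (initial_ideal (image_ideal (lin_change A) P)) J.
Implicit Types (f g : {mpoly k[n]}) (m : 'X_{1..n}) (A : 'M[k]_n).

Lemma zariski_open_unitmx A : U A -> A \in unitmx.
Proof. by case: openU => F hF /hF[]. Qed.

Lemma prime_coordinates A : U A -> is_prime_ideal (image_ideal (lin_change A) P).
Proof. by move=> /zariski_open_unitmx uA; apply: is_prime_ideal_lin_change. Qed.

Lemma gin_monomialP A m : U A ->
  J 'X_[m] <-> exists2 f, image_ideal (lin_change A) P f & is_initial f m.
Proof.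
move=> UA; have [idP _ _] := prime_coordinates UA.
by rewrite -(initial_ideal_monomialP m idP); split=> /(ginJ UA).
Qed.

Hypothesis idJ : is_ideal J.
Variable ubar : 'X_{1..n}.
Hypothesis Phi_ubar : Phi r ubar = ubar.
Hypothesis Phi_dichotomy :
  forall m, J 'X_[m] -> J 'X_[Phi r m] \/ Phi r m = ubar.
Hypothesis ubar_notin : ~ J 'X_[ubar].

(** Two systems of coordinates are compared: those given by [A], and their generic
    shear, which has the same initial ideal [J].  The shear keeps reduced
    elements reduced. *)
Lemma gin_contains_power A m : U A -> J 'X_[m] -> Phi r m = ubar ->
  exists d, J 'X_[(ubar + U_(rho) *+ d)%MM].
Proof.
move=> UA Jm em.
have [g Pg [ing redg]] := exists_reduced (prime_coordinates UA) idJ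
  (fun a => gin_monomialP a UA) ubar_notin Jm em.
set b := (coefs_over_last r g)@_ubar.
have lb : in_last r b by apply: in_last_coef.
have b0 : b != 0 by rewrite /b -em; apply: mem_msupp_coefs; case: ing.
pose d := (msize b).-1.
have [|l [Ul ul hl]] := generic_shear rho hk openU UA (h := pihomog mdeg d b).
  have ed : mdeg (mlead b) = d by rewrite /d -mlead_deg.
  apply: contraNneq b0 => e0; have := mcoeff_pihomog b d (mlead b).
  by rewrite e0 mcoeff0 ed eqxx => /esym/eqP; rewrite mleadc_eq0.
exists d; set m1 := (ubar + U_(rho) *+ d)%MM; pose f := lin_change (shear rho l) g.
have coef_f w : (coefs_over_last r f)@_w =
    lin_change (shear rho l) (coefs_over_last r g)@_w.
  exact: coefs_over_last_shear.
have Phi_m1 : Phi r m1 = ubar.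
  rewrite PhiD Phi_ubar -[RHS]addm0; congr (_ + _)%MM; apply/mnmP => i.
  rewrite PhiE mulmnE mnm1E mnm0E; case: ifP => // ir.
  by case: (rho =P i) => // e; rewrite -e ltnn in ir.
have m1f : m1 \in msupp f.
  have : (U_(rho) *+ d)%MM \in msupp (coefs_over_last r f)@_ubar.
    by rewrite coef_f mcoeff_msupp mcoeff_shear_power.
  move=> /msupp_coefs_over_last[a af [ea ya]].
  by rewrite /m1 addmC -ya -ea Psi_Phi.
have Pf : image_ideal (lin_change (shear rho l *m A)) P f.
  by case: Pg => p Pp eg; exists p; [exact: Pp | rewrite /f eg lin_change_comp].
have redf : reduced (Phi_mem r J) f.
  apply/reducedP => w Jw ew; rewrite coef_f.
  by move/reducedP: redg => ->//; rewrite rmorph0.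
have f0 : f != 0 by apply: contraTneq m1f => ->; rewrite msupp0.
have [m' inf em'] := reduced_initial (fun a => gin_monomialP a Ul) Phi_dichotomy
  Pf redf f0.
suff <- : m' = m1 by apply/(gin_monomialP _ Ul); exists f.
apply/eqP/negPn/negP => ne; have [m'f lt] := inf.
have {lt} : grevlex_lt m1 m' by apply: lt => //; rewrite eq_sym.
have split_deg (a : 'X_{1..n}) : mdeg a = (mdeg (Psi r a) + mdeg (Phi r a))%N.
  by rewrite -mdegD Psi_Phi.
have Psi_m1 : Psi r m1 = (U_(rho) *+ d)%MM.
  by rewrite -[LHS](addmK ubar) -{1}Phi_m1 Psi_Phi /m1 addmC addmK.
have deg' : (mdeg (Psi r m') <= d)%N.
  rewrite -ltnS /d -mpolySpred //.
  apply: (@lin_change_mdeg_lt _ _ (shear rho l)).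
  by rewrite -coef_f -em' mcoeff_msupp mcoeff2_coefs_over_last -mcoeff_msupp.
have degd : mdeg (Psi r m1) = d by rewrite Psi_m1 mdegMn mdeg1 mul1n.
(* [m1] has the largest degree possible, and no monomial of that degree with
   first part [ubar] exceeds it. *)
case/grevlex_ltP; rewrite (split_deg m1) (split_deg m') Phi_m1 em' degd.
  by rewrite ltn_add2r ltnNge deg'.
case=> /addIn e [i lti eqi].
have m1_last (j : 'I_n) : (r < j)%N -> m1 j = 0%N.
  move=> rj; have := PsiE r m1 j; rewrite ltnNge (ltnW rj) /= => <-.
  by rewrite Psi_m1 mulmnE mnm1E; case: (rho =P j) => // ej; rewrite ej ltnn in rj.
have [ir|ri|ei] := ltngtP i rho.
- have same : m1 i = m' i.
    have := congr1 (fun a : 'X_{1..n} => a i) (etrans Phi_m1 (esym em')).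
    by rewrite /= !PhiE ir.
  by rewrite same ltnn in lti.
- by rewrite m1_last in lti.
- move/val_inj: ei => ei; subst i.
  have ed : mdeg (Psi r m') = m' rho.
    rewrite mdegE (bigD1 rho) //= PsiE ltnn big1 ?addn0 // => j jr.
    rewrite PsiE; case: ltnP => // rj.
    rewrite -eqi; last by rewrite ltn_neqAle rj andbT eq_sym.
    by apply: m1_last; rewrite ltn_neqAle rj andbT eq_sym.
  have := PsiE r m1 rho; rewrite ltnn Psi_m1 mulmnE mnm1E eqxx mul1n => ed1.
  by move: lti; rewrite -ed -e -ed1 ltnn.
Qed.

End GenericInitialIdeal.

(** * Truncation to the first variables *)

Section Truncation.
Variables (n r : nat) (k : fieldType).
Hypothesis hrn : (r < n)%N.
Implicit Types (w : 'X_{1..r}) (m : 'X_{1..n}) (f : {mpoly k[n]}).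

Lemma mnm_embedE w (i : 'I_n) (ir : (i < r)%N) : mnm_embed n w i = w (Ordinal ir).
Proof. by rewrite mnmE insubT. Qed.

Lemma mnm_embed_first w : mnm_in_first r (mnm_embed n w).
Proof. by move=> i ri; rewrite mnmE insubF // ltnNge ri. Qed.

Definition mnm_restrict m : 'X_{1..r} :=
  [multinom m (widen_ord (ltnW hrn) i) | i < r].

Lemma mnm_restrictK m : mnm_in_first r m -> mnm_embed n (mnm_restrict m) = m.
Proof.
move=> fm; apply/mnmP => i; have [ir|ri] := ltnP i r.
  by rewrite mnm_embedE mnmE; congr (m _); apply: val_inj.
by rewrite fm // mnm_embed_first.
Qed.

Lemma mnm_embedK w : mnm_restrict (mnm_embed n w) = w.
Proof.
apply/mnmP => i; have ir : (widen_ord (ltnW hrn) i < r)%N by exact: (ltn_ord i).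
by rewrite mnmE mnm_embedE; congr (w _); apply: val_inj.
Qed.

Lemma mnm_embedD w w' :
  mnm_embed n (w + w')%MM = (mnm_embed n w + mnm_embed n w')%MM.
Proof.
by apply/mnmP => i; rewrite mnmDE !mnmE; case: insub => // j; rewrite mnmDE.
Qed.

Lemma PiX_embed w : Pi r 'X_[mnm_embed n w] = 'X_[w] :> {mpoly k[r]}.
Proof.
rewrite /Pi comp_mpolyX [RHS]mpolyXE_id.
pose F i : {mpoly k[r]} := if insub i is Some j then 'X_(j : 'I_r) ^+ w j else 1.
rewrite (eq_bigr (fun i : 'I_n => F i)); last first.
  move=> i _; rewrite tnth_mktuple mnmE /F.
  by case: insub => // ; rewrite expr0.
rewrite (eq_bigr (fun i : 'I_r => F i)) => [|i _]; last by rewrite /F valK.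
rewrite (big_ord_widen n (fun i => F i) (ltnW hrn)) [RHS]big_mkcond /=.
apply: eq_bigr => i _; case: ltnP => // ri.
by rewrite /F insubF // ltnNge ri.
Qed.

Lemma mcoeff_Pi f w : (Pi r f)@_w = f@_(mnm_embed n w).
Proof.
rewrite {1}[f]mpolyE [in RHS](mpolyE f) /Pi (raddf_sum (comp_mpoly _)) !raddf_sum /=.
apply: eq_bigr => m _; rewrite comp_mpolyZ !mcoeffZ; congr (_ * _).
have [fm|nfm] := classic (mnm_in_first r m).
  rewrite -{1}(mnm_restrictK fm) -/(Pi r _) PiX_embed !mcoeffX.
  congr (_%:R); congr nat_of_bool; apply/eqP/eqP => [<-|->].
    by rewrite mnm_restrictK.
  by rewrite mnm_embedK.
have [i [ri mi]] : exists i : 'I_n, (r <= i)%N /\ m i <> 0%N.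
  apply: NNPP => h; apply: nfm => i ri; apply: NNPP => mi.
  by apply: h; exists i.
rewrite comp_mpolyX (bigD1 i) //= tnth_mktuple insubF ?ltnNge ?ri //.
rewrite expr0n (introF eqP mi) mul0r mcoeff0 mcoeffX.
case: eqP => // e; by case: mi; rewrite e mnm_embed_first.
Qed.

Lemma mem_msupp_Pi f w : (w \in msupp (Pi r f)) = (mnm_embed n w \in msupp f).
Proof. by rewrite !mcoeff_msupp mcoeff_Pi. Qed.

End Truncation.

Lemma exists_min_mon_gen (n : nat) (k : fieldType) (J : {mpoly k[n]} -> Prop)
    (m : 'X_{1..n}) :
  J 'X_[m] -> exists2 m', min_mon_gen J m' & (m' <= m)%MM.
Proof.
move=> Jm; have [|m' [Jm' le] minm'] := exists_min (@mdeg n)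
  (Q := fun m' => J 'X_[m'] /\ (m' <= m)%MM).
  by exists m; split=> //; apply: lepm_refl.
exists m' => //; split=> // m2 Jm2 le2.
have := minm' m2 (conj Jm2 (lepm_trans le2 le)).
rewrite -{1}(submK le2) mdegD -[X in (_ <= X)%N]add0n leq_add2r leqn0 mdeg_eq0.
by move=> /eqP e; rewrite -(submK le2) e add0m.
Qed.

(** * The extra generator *)

Theorem theorem4p2 (k : fieldType) (n : nat) (P J : {mpoly k[n]} -> Prop)
    (r : nat) (u : 'X_{1..r})
    (hk : infinite_field k)
    (hPhom : is_homogeneous_ideal P) (hPprime : is_prime_ideal P)
    (hJ : is_gin P J)
    (hr : (1 <= r)%N) (hrn : (r < n)%N)
    (hu_colon : ideal_colon (@Pi_ideal n r k J) (@max_ideal r k) 'X_[u])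
    (hu_notin : ~ @Pi_ideal n r k J 'X_[u])
    (hPhi : same_ideal (@Phibar_ideal n r k J)
       (ideal_add (@Pi_ideal n r k J) (ideal_gen (fun g => g = 'X_[u])))) :
  [/\ (u = 0%MM /\
         forall f : {mpoly k[n]},
           ideal_gen (fun g => exists2 i : 'I_n, (i < r)%N & g = 'X_i) f -> J f)
      \/ (exists v : 'X_{1..n}, extra_generator r J v),
      u <> 0%MM ->
        forall v : 'X_{1..n}, extra_generator r J v ->
          exists2 e : nat, (0 < e)%N &
            v = (mnm_embed n u + U_(Ordinal hrn) *+ e)%MM
    & u <> 0%MM ->
        exists2 M : 'X_{1..n} -> Prop,
          forall m, M m -> mnm_in_first r.+1 m &
          same_ideal J (ideal_gen (fun g => exists2 m, M m & g = 'X_[m]))].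
Proof.
have [U [openU [A UA] ginJ]] := hJ.
have idJ : is_ideal J.
  have [I0 ID IM] : is_ideal (initial_ideal (image_ideal (lin_change A) P)).
    exact: is_ideal_gen.
  split.
  - exact/(ginJ A UA).
  - by move=> a b /(ginJ A UA) Ja /(ginJ A UA) Jb; apply/(ginJ A UA)/ID.
  - by move=> c a /(ginJ A UA) Ja; apply/(ginJ A UA)/IM.
have [_ _ JM] := idJ.
have J_msupp f m : J f -> m \in msupp f -> J 'X_[m].
  by move=> /(ginJ A UA) Jf mf; apply/(ginJ A UA)/(initial_ideal_msupp Jf mf).
have Jle m m' : (m <= m')%MM -> J 'X_[m] -> J 'X_[m'].
  exact: ideal_monomial_le.
have PiJP (g : {mpoly k[r]}) w :
    Pi_ideal J g -> w \in msupp g -> J 'X_[mnm_embed n w].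
  by case=> f Jf ->; rewrite mem_msupp_Pi //; apply: J_msupp Jf.
set ubar := mnm_embed n u.
have Phi_ubar : Phi r ubar = ubar by apply/Phi_id/mnm_embed_first.
have ubar_notin : ~ J 'X_[ubar].
  by move=> Ju; apply: hu_notin; exists 'X_[ubar]; rewrite // PiX_embed.
have above_ubar a : mnm_in_first r a -> (ubar <= a)%MM -> a <> ubar -> J 'X_[a].
  move=> fa le ne.
  have [i lti] : exists i, (ubar i < a i)%N.
    apply: NNPP => h; apply: ne; apply/mnmP => i; apply/eqP.
    rewrite eqn_leq (mnm_lepP le) andbT leqNgt; apply/negP => lt.
    by apply: h; exists i.
  have ir : (i < r)%N.
    by rewrite ltnNge; apply/negP => ri; rewrite fa in lti.
  have Jui : J 'X_[mnm_embed n (u + U_(Ordinal ir))%MM].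
    apply: (PiJP ('X_[u] * 'X_(Ordinal ir))).
      by apply: hu_colon; apply: mem_ideal_gen; exists (Ordinal ir).
    by rewrite -mpolyXD; apply/mem_msuppXP.
  apply: Jle Jui; apply/mnm_lepP => j; rewrite mnm_embedD mnmDE -/ubar.
  have [jr|rj] := ltnP j r.
    rewrite mnm_embedE mnm1E -val_eqE /=.
    case: (i =P j :> nat) => [/val_inj <-|_]; first by rewrite addn1.
    by rewrite addn0 (mnm_lepP le).
  by rewrite (mnm_embed_first _ rj) addn0 (mnm_lepP le).
(* [hPhi] leaves two cases: the first part lies in [J], or [u] divides it; in the
   second case the colon condition leaves only [u] itself outside [J]. *)
have gen_dichotomy m : min_mon_gen J m -> J 'X_[Phi r m] \/ Phi r m = ubar.
  move=> mingen; pose w := mnm_restrict hrn (Phi r m).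
  have ew : mnm_embed n w = Phi r m by apply/mnm_restrictK/Phi_first.
  have /hPhi[a [b [Ja ub eab]]] : @Phibar_ideal n r k J 'X_[w].
    exists 'X_[Phi r m]; first by apply: mem_ideal_gen; exists m.
    by rewrite -ew PiX_embed.
  have /mem_msuppD[/(PiJP _ _ Ja)|wb] : w \in msupp (a + b).
  - by rewrite -eab; apply/mem_msuppXP.
  - by rewrite ew; left.
  have [_ [_ [-> /mem_msuppXP <- le]]] := ideal_gen_msupp ub wb.
  have [e|ne] := eqVneq (Phi r m) ubar; [by right | left].
  apply: above_ubar; [exact: Phi_first | | exact/eqP].
  rewrite -ew -(submK le) mnm_embedD; exact: lem_addl.
have Phi_mono m m' : (m <= m')%MM -> (Phi r m <= Phi r m')%MM.
  by move=> /submK <-; rewrite PhiD lem_addl.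
have Phi_dichotomy m : J 'X_[m] -> J 'X_[Phi r m] \/ Phi r m = ubar.
  move=> /exists_min_mon_gen[m' /gen_dichotomy Jm' /Phi_mono le].
  have [e|ne] := eqVneq (Phi r m) ubar; [by right | left].
  case: Jm' => [|e]; first exact: Jle.
  by apply: above_ubar; [exact: Phi_first | rewrite -e | exact/eqP].
have exists_ubar : exists2 m, J 'X_[m] & Phi r m = ubar.
  have /hPhi[f If ef] :
      ideal_add (@Pi_ideal n r k J) (ideal_gen (fun g => g = 'X_[u])) 'X_[u].
    exists 0, 'X_[u]; split; rewrite ?add0r //; last exact: mem_ideal_gen.
    by exists 0; [case: idJ | rewrite /Pi rmorph0].
  have uf : ubar \in msupp f.
    by rewrite -mem_msupp_Pi // -ef; apply/mem_msuppXP.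
  have [_ [_ [[m mingen ->] /mem_msuppXP <- le]]] := ideal_gen_msupp If uf.
  exists m; first by case: mingen.
  by have [/(Jle _ _ le)|] := gen_dichotomy m mingen.
have [u0|une] := classic (u = 0%MM).
  split=> //; left; split=> // f; apply: ideal_gen_sub => // _ [i ir ->].
  have ubar0 : ubar = 0%MM.
    apply/mnmP => j; rewrite /ubar u0 mnmE mnm0E.
    by case: insub => // l; rewrite mnm0E.
  apply: above_ubar; rewrite ?ubar0.
  - move=> j rj; rewrite mnm1E; case: (i =P j) => // e.
    by rewrite -e leqNgt ir in rj.
  - by apply/mnm_lepP => j; rewrite mnm0E.
  - by apply/eqP; rewrite mnm1_eq0.
have ubar_neq0 : ubar != 0%MM.
  apply/eqP => e; apply: une; rewrite -[u](mnm_embedK hrn) -/ubar e.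
  by apply/mnmP => i; rewrite mnmE !mnm0E.
have [v [Jv Phi_v leastv]] := least_initial_monomial
  (prime_coordinates hPprime openU UA) idJ
  (fun m => gin_monomialP hPprime openU ginJ m UA)
  ubar_notin Phi_dichotomy ubar_neq0 exists_ubar.
pose rho := Ordinal hrn.
have [e ev] : exists e, v = (ubar + U_(rho) *+ e)%MM.
  have [m1 Jm1 em1] := exists_ubar.
  have [d Jd] := @gin_contains_power n k rho P J U hk hPprime openU ginJ idJ
    ubar Phi_ubar Phi_dichotomy ubar_notin A m1 UA Jm1 em1.
  have Phi_d : Phi r (ubar + U_(rho) *+ d)%MM = ubar.
    rewrite PhiD Phi_ubar -[RHS]addm0; congr (_ + _)%MM; apply/mnmP => i.
    rewrite PhiE mulmnE mnm1E mnm0E; case: ifP => // ir.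
    by case: (rho =P i) => // ei; rewrite -ei /= ltnn in ir.
  exists (v rho); rewrite -{1}[v](Psi_Phi r) Phi_v addmC; congr (_ + _)%MM.
  apply/mnmP => i; rewrite PsiE mulmnE mnm1E.
  have := mnm_lepP (leastv _ Jd Phi_d) i; rewrite mnmDE mulmnE mnm1E.
  case: (rho =P i) => [<-|ne] le; first by rewrite /= ltnn mul1n.
  case: ltnP => // ri; apply/eqP; rewrite mul0n -leqn0; apply: leq_trans le _.
  by rewrite (mnm_embed_first _ ri).
have e_gt0 : (0 < e)%N.
  rewrite lt0n; apply/eqP => e0; apply: ubar_notin.
  by rewrite -[ubar]addm0 -(mulm0n U_(rho)) -e0 -ev.
pose F g := J g /\ in_first r g.
have F_notin m : Phi r m = ubar -> ~ ideal_gen F 'X_[m].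
  move=> em Fm.
  have [g [m0 [[Jg fg] m0g le]]] := ideal_gen_msupp Fm (proj1 (is_initial_X k m)).
  apply: ubar_notin; apply: (Jle m0); last exact: J_msupp m0g.
  by rewrite -em -(Phi_id (fg _ m0g)); apply: Phi_mono.
have J_cases m : J 'X_[m] -> F 'X_[Phi r m] \/ Phi r m = ubar /\ (v <= m)%MM.
  move=> Jm; case: (Phi_dichotomy m Jm) => [JPhi|em]; [left | right].
    by split=> // _ /mem_msuppXP <-; apply: Phi_first.
  by split=> //; apply: leastv.
have extra_v : extra_generator r J v.
  split; first exact: F_notin.
  move=> f; split=> [Jf|]; last first.
    by apply: ideal_gen_sub => // g [[]|->].
  apply: ideal_of_monomials; first exact: is_ideal_gen.
  move=> m /(J_msupp _ _ Jf)/J_cases[Fm|[_ le]].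
    apply: (ideal_monomial_le (is_ideal_gen _) (Phi_le r m)).
    by apply: mem_ideal_gen; left.
  apply: (ideal_monomial_le (is_ideal_gen _) le).
  by apply: mem_ideal_gen; right.
split=> [|_ v' [v'F v'J]|_].
- by right; exists v.
- exists e => //; rewrite -/ubar -ev.
  (* The extra generators [v] and [v'] divide each other. *)
  have Jv' : J 'X_[v'] by apply/v'J; apply: mem_ideal_gen; right.
  have le : (v <= v')%MM.
    have [Fv'|[]//] := J_cases _ Jv'; case: v'F.
    apply: (ideal_monomial_le (is_ideal_gen _) (Phi_le r v')).
    exact: mem_ideal_gen.
  have [g [m0 [[Fg|->] m0g le0]]] :=
    ideal_gen_msupp (proj1 (v'J 'X_[v]) Jv) (proj1 (is_initial_X k v)).
    case: (F_notin v Phi_v).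
    apply: (ideal_monomial_le (is_ideal_gen _) le0).
    apply: mem_ideal_gen; split; first by apply: J_msupp m0g; case: Fg.
    by move=> _ /mem_msuppXP <-; case: Fg => _; apply.
  move: m0g le0 => /mem_msuppXP <- le'.
  by apply/mnmP => i; apply/eqP; rewrite eqn_leq (mnm_lepP le) (mnm_lepP le').
- exists (fun m => J 'X_[m] /\ mnm_in_first r.+1 m) => [m []//|f].
  split=> [Jf|]; last by apply: ideal_gen_sub => // _ [m [Jm _] ->].
  apply: ideal_of_monomials; first exact: is_ideal_gen.
  move=> m /(J_msupp _ _ Jf)/J_cases[[JPhi _]|[_ le]].
    apply: (ideal_monomial_le (is_ideal_gen _) (Phi_le r m)).
    apply: mem_ideal_gen; exists (Phi r m) => //; split=> // i ri.
    by apply: Phi_first; apply: ltnW.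
  apply: (ideal_monomial_le (is_ideal_gen _) le).
  apply: mem_ideal_gen; exists v => //; split=> // i ri.
  rewrite ev mnmDE (mnm_embed_first _ (ltnW ri)) mulmnE mnm1E.
  by case: (rho =P i) => // ei; rewrite -ei /= ltnn in ri.
Qed.
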